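(* Let $\lambda$ be a positive integer and $k=2\lambda+1$. Then there exists an integer $v_0$ such that for every $v\geq v_0$ with $v\equiv 1\pmod{2k}$, there exists a $(v,k,\lambda)$-BIBD having a perfect nesting.
   Context: A $(v,k,\lambda)$-packing (resp. BIBD) is a pair $(X,\mathcal{B})$ with $|X|=v$ and $\mathcal{B}$ a (multi)set of $k$-subsets of $X$ (blocks) such that every pair of distinct points lies in at most (resp. exactly) $\lambda$ blocks. A nesting of a $(v,k,\lambda)$-BIBD $(X,\mathcal{B})$ is a map $\phi:\mathcal{B}\to X$ such that $(X,\{B\cup\{\phi(B)\}\mid B\in\mathcal{B}\})$ is a $(v,k+1,\lambda+1)$-packing; it is a perfect nesting if this packing is in fact a $(v,k+1,\lambda+1)$-BIBD. *)

(* Defs.v *)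
From mathcomp Require Import all_boot.

Set Implicit Arguments.
Unset Strict Implicit.
Unset Printing Implicit Defensive.

(* A multiset of blocks on X is a family B : I -> {set X} indexed by a finite
   type I, so that repeated blocks carry distinct indices and counting blocks
   means counting indices. *)

Definition pair_count (X I : finType) (B : I -> {set X}) (x y : X) : nat :=
  #|[set i | (x \in B i) && (y \in B i)]|.

Definition is_packing (v k lambda : nat) (X I : finType) (B : I -> {set X})
    : Prop :=
  [/\ #|X| = v,
      forall i, #|B i| = k &
      forall x y : X, x != y -> pair_count B x y <= lambda].

Definition is_BIBD (v k lambda : nat) (X I : finType) (B : I -> {set X})
    : Prop :=
  [/\ #|X| = v,
      forall i, #|B i| = k &
      forall x y : X, x != y -> pair_count B x y = lambda].

Definition nested_blocks (X I : finType) (B : I -> {set X}) (phi : I -> X)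
    : I -> {set X} :=
  fun i => B i :|: [set phi i].

(* Being a packing with block size k + 1 forces phi i \notin B i when
   #|B i| = k. *)
Definition is_nesting (v k lambda : nat) (X I : finType) (B : I -> {set X})
    (phi : I -> X) : Prop :=
  is_BIBD v k lambda B /\
  is_packing v (k + 1) (lambda + 1) (nested_blocks B phi).

Definition is_perfect_nesting (v k lambda : nat) (X I : finType)
    (B : I -> {set X}) (phi : I -> X) : Prop :=
  is_nesting v k lambda B phi /\
  is_BIBD v (k + 1) (lambda + 1) (nested_blocks B phi).

(* Main.v *)
(** Call a family of k-sets with apexes "nested" over a multigraph when the edges
from each apex to its k leaves cover every edge of the graph once, and the pairs
of leaves cover it lambda times; a perfect nesting is such a family over the
complete graph K_v.  Put m = 2k.

- Over a field with q = 1 (mod m) elements, the translates of the cosets of the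
  group H of k-th roots of unity (one in each coset of H u -H), with apex at the
  translate of 0, give a nested family over K_q.
- The lattice spanned by the pairs (star, clique) of all possible blocks on r
  points contains every vector whose degrees agree with those of a combination
  of blocks, because it contains all alternating 4-cycles.  So for all large
  admissible N there is a family covering each edge of K_r exactly N times.
- If p divides N, blowing up every point to a copy of GF(p^d), d large, reduces N
  to N/p: the blocks through each pair are coloured equitably by F_p and lifted
  along vertex potentials realising the colours.  Iterating, one gets a nested
  family over a complete multipartite graph with r parts of equal size Q.
- With N = 1 (mod D) one may take Q = 1 (mod D) and fill the parts: K_(rQ) has a
  nested family, so admissible orders occur in every class 1 (mod m) of every
  modulus.  With N a power of m one gets parts of size w = m^E, simultaneously
  for all r in a long interval, and then for all large r by truncated
  transversal designs.
- Truncated transversal designs with weight w, completed by f extra points, fill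
  each class modulo w from finitely many orders in it. *)

From HB Require Import structures.
From mathcomp Require Import all_boot all_order all_algebra.
From mathcomp Require Import all_fingroup all_solvable all_field.
From mathcomp Require Import zify ring.
Require Import Defs.

Set Implicit Arguments.
Unset Strict Implicit.
Unset Printing Implicit Defensive.
Import GRing.Theory.

(** * Nested families over multigraphs *)

(* Positions in a block: [None] is the apex, [Some i] the leaves; k = 2 lam + 1. *)
Definition star_index (lam : nat) := option 'I_lam.*2.+1.

(* [t = true] selects the star edges, [t = false] the edges of the leaf clique. *)
Definition incid (lam : nat) (t : bool) (i j : star_index lam) : bool :=
  if t then (i == None) (+) (j == None) else [&& i != None, j != None & i != j].

Definition mult (lam : nat) (t : bool) : nat := if t then 1 else lam.

(** Positions form ordered pairs, so an edge of a block counts once at [(x, y)] and once at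
    [(y, x)]. *)
Definition cov (lam : nat) (X : finType) (t : bool)
    (b : {ffun star_index lam -> X}) (x y : X) : nat :=
  \sum_i \sum_j incid t i j * ((b i == x) && (b j == y)).

(* Blocks are not required to be injective: this follows from the equation at
   [x = y] whenever [sigma] vanishes on the diagonal (see [dec_blocks_inj]). *)
Definition dec (lam : nat) (X : finType) (sigma : X -> X -> nat) : Prop :=
  exists s : seq {ffun star_index lam -> X}, forall t x y,
    \sum_(b <- s) cov t b x y = mult lam t * sigma x y.

Lemma incidC lam t (i j : star_index lam) : incid t i j = incid t j i.
Proof.
case: t; rewrite /incid; first exact: addbC.
by rewrite (eq_sym i j); case: (i != None); case: (j != None).
Qed.

Lemma incidii lam t (i : star_index lam) : incid t i i = false.
Proof. by case: t; rewrite /incid ?addbb // eqxx !andbF. Qed.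

Lemma incid_neq lam t (i j : star_index lam) : incid t i j -> i != j.
Proof. by apply: contraTneq => ->; rewrite incidii. Qed.

Lemma covC lam (X : finType) t (b : {ffun star_index lam -> X}) x y :
  cov t b x y = cov t b y x.
Proof.
rewrite /cov exchange_big; apply: eq_bigr => i _; apply: eq_bigr => j _.
by rewrite incidC andbC.
Qed.

Lemma dec_ext lam (X : finType) (s1 s2 : X -> X -> nat) :
  (forall x y, s1 x y = s2 x y) -> dec lam s1 -> dec lam s2.
Proof. by move=> e [s hs]; exists s => t x y; rewrite hs e. Qed.

Lemma dec0 lam (X : finType) : dec lam (fun _ _ : X => 0).
Proof. by exists [::] => t x y; rewrite big_nil muln0. Qed.

Lemma decD lam (X : finType) (s1 s2 : X -> X -> nat) :
  dec lam s1 -> dec lam s2 -> dec lam (fun x y => s1 x y + s2 x y).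
Proof.
move=> [l1 h1] [l2 h2]; exists (l1 ++ l2) => t x y.
by rewrite big_cat /= h1 h2 mulnDr.
Qed.

Lemma dec_sum lam (X : finType) (T : finType) (A : pred T) (s : T -> X -> X -> nat) :
  (forall j, A j -> dec lam (s j)) ->
  dec lam (fun x y => \sum_(j | A j) s j x y).
Proof.
move=> h; have: forall l : seq T, dec lam (fun x y => \sum_(j <- l | A j) s j x y).
  elim=> [|a l IH]; first by apply: dec_ext (dec0 lam X) => x y; rewrite big_nil.
  case Aa: (A a).
    by apply: dec_ext (decD (h a Aa) IH) => x y; rewrite big_cons Aa.
  by apply: dec_ext IH => x y; rewrite big_cons Aa.
exact.
Qed.

Lemma dec_muln lam (X : finType) (s : X -> X -> nat) n :
  dec lam s -> dec lam (fun x y => n * s x y).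
Proof.
move=> h; have := @dec_sum lam X 'I_n predT (fun _ => s) (fun _ _ => h).
by apply: dec_ext => x y; rewrite sum_nat_const card_ord.
Qed.

Lemma dec_map lam (Y X : finType) (h : Y -> X) (s : Y -> Y -> nat)
    (s' : X -> X -> nat) :
  injective h -> (forall a b, s' (h a) (h b) = s a b) ->
  (forall x y, 0 < s' x y -> (x \in codom h) && (y \in codom h)) ->
  dec lam s -> dec lam s'.
Proof.
move=> hi hs hz [l hl]; exists [seq [ffun i => h (b i)] | b : {ffun star_index lam -> Y} <- l].
move=> t x y; rewrite big_map.
case hx: (x \in codom h); last first.
  rewrite big1 => [|b _].
    by case: posnP (hz x y) => [->|_ /(_ isT)]; rewrite ?muln0 // hx.
  rewrite /cov big1 // => i _; rewrite big1 // => j _; rewrite !ffunE.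
  by case: eqP => [e|_]; rewrite ?muln0 //; rewrite -e codom_f in hx.
case hy: (y \in codom h); last first.
  rewrite big1 => [|b _].
    by case: posnP (hz x y) => [->|_ /(_ isT)]; rewrite ?muln0 // hy andbF.
  rewrite /cov big1 // => i _; rewrite big1 // => j _; rewrite !ffunE.
  by case: (h (b j) =P y) => [e|_]; rewrite ?andbF ?muln0 //; rewrite -e codom_f in hy.
have /codomP [a ->] := hx; have /codomP [c ->] := hy; rewrite hs -hl.
apply: eq_bigr => b _; apply: eq_bigr => i _; apply: eq_bigr => j _.
by rewrite !ffunE !(inj_eq hi).
Qed.

Lemma dec_bij lam (Y X : finType) (h : Y -> X) (s : Y -> Y -> nat)
    (s' : X -> X -> nat) :
  bijective h -> (forall a b, s' (h a) (h b) = s a b) ->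
  dec lam s -> dec lam s'.
Proof.
move=> hb hs; apply: dec_map hs _; first exact: bij_inj.
have [g _ gK] := hb => x y _.
by rewrite -(gK x) -(gK y) !codom_f.
Qed.

(** * Complete, complete multipartite and holed graphs *)

Definition nestable (lam v : nat) := dec lam (fun x y : 'I_v => x != y).
(* The complete multipartite graph with [r] groups of size [w]. *)
Definition gdd (lam w r : nat) :=
  dec lam (fun x y : 'I_r * 'I_w => x.1 != y.1).
(* The complete graph on [g + f] points minus the clique on the last [f]. *)
Definition holed (lam g f : nat) :=
  dec lam (fun x y : 'I_g + 'I_f => (x != y) && (is_inl x || is_inl y)).

Lemma nestable_on lam (X : finType) (A : {set X}) :
  nestable lam #|A| ->
  dec lam (fun x y => [&& x \in A, y \in A & x != y]).
Proof.
apply: (dec_map (h := @enum_val X (mem A))); first exact: enum_val_inj.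
  by move=> a b; rewrite !enum_valP (inj_eq enum_val_inj).
move=> x y; rewrite lt0b => /and3P [hx hy _].
by rewrite -(enum_rankK_in hx hx) -(enum_rankK_in hy hy) !codom_f.
Qed.

Lemma nestable_card lam (X : finType) v : #|X| = v ->
  nestable lam v <-> dec lam (fun x y : X => x != y).
Proof.
move=> e; split.
  rewrite -e => h; have := @nestable_on lam X [set: X].
  by rewrite cardsT => /(_ h); apply: dec_ext => x y; rewrite !inE.
subst v; apply: (dec_bij (h := enum_rank)); first exact: enum_rank_bij.
by move=> a b; rewrite (inj_eq enum_rank_inj).
Qed.

Lemma gdd_on lam w (Z : finType) (A : {set Z}) :
  gdd lam w #|A| ->
  dec lam (fun x y : Z * 'I_w => [&& x.1 \in A, y.1 \in A & x.1 != y.1]).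
Proof.
apply: (dec_map (h := fun p => (@enum_val Z (mem A) p.1, p.2))).
- by move=> [a1 a2] [b1 b2] /= [/enum_val_inj -> ->].
- by move=> a b /=; rewrite !enum_valP (inj_eq enum_val_inj).
move=> [x1 x2] [y1 y2] /=; rewrite lt0b => /and3P [hx hy _].
apply/andP; split; apply/codomP.
  by exists (enum_rank_in hx x1, x2); rewrite /= enum_rankK_in.
by exists (enum_rank_in hy y1, y2); rewrite /= enum_rankK_in.
Qed.

Lemma gdd_le1 lam w r : r <= 1 -> gdd lam w r.
Proof.
move=> hr; apply: dec_ext (dec0 lam _) => -[x1 x2] [y1 y2] /=.
suff -> : x1 = y1 by rewrite eqxx.
by apply: ord_inj; have := ltn_ord x1; have := ltn_ord y1; lia.
Qed.

Lemma holed_on lam (X : finType) (A B : {set X}) g f :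
  #|A| = g -> #|B| = f -> [disjoint A & B] -> holed lam g f ->
  dec lam (fun x y => [&& x \in A :|: B, y \in A :|: B, x != y &
                          (x \in A) || (y \in A)]).
Proof.
move=> <- <- dAB.
have dB z : z \in B -> z \in A = false.
  by move=> zB; apply: contraTF dAB => zA; apply/pred0Pn; exists z; rewrite /= zA.
have nAB (a : 'I_#|A|) (b : 'I_#|B|) : enum_val a != enum_val b.
  by apply: contraTneq (enum_valP a) => ->; rewrite dB // enum_valP.
pose h (p : 'I_#|A| + 'I_#|B|) := match p with inl a => enum_val a | inr b => enum_val b end.
apply: (dec_map (h := h)).
- move=> [a|a] [b|b] //= e; last 1 [by congr inr; apply: enum_val_inj];
    [by congr inl; apply: enum_val_inj | |].
  + by have := nAB a b; rewrite e eqxx.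
  + by have := nAB b a; rewrite e eqxx.
- have e1 a b : (enum_val a == enum_val b :> X) = (inl a == inl b :> 'I_#|A| + 'I_#|B|).
    exact: (inj_eq enum_val_inj).
  have e2 a b : (enum_val a == enum_val b :> X) = (inr a == inr b :> 'I_#|A| + 'I_#|B|).
    exact: (inj_eq enum_val_inj).
  move=> [a|a] [b|b] /=; rewrite !inE !enum_valP ?orbT ?andbT /=.
  + by rewrite e1.
  + by rewrite nAB.
  + by rewrite eq_sym nAB.
  + by rewrite !(dB _ (enum_valP _)) /= !andbF.
move=> x y; rewrite lt0b => /and4P [hx hy _ _].
suff H z : z \in A :|: B -> z \in codom h by rewrite !H.
rewrite inE => /orP [hz|hz]; apply/codomP.
  by exists (inl (enum_rank_in hz z)); rewrite /= enum_rankK_in.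
by exists (inr (enum_rank_in hz z)); rewrite /= enum_rankK_in.
Qed.

(** * Transversal designs *)

(** A transversal design as an orthogonal array: [K] indexes the groups, [T] the blocks, and block
    [th] meets group [i] in [f th i]. *)
Definition td (K : finType) (n : nat) : Prop :=
  exists (T : finType) (f : T -> K -> 'I_n), forall i j a b, i != j ->
    \sum_th ((f th i == a) && (f th j == b)) = 1.

Lemma sum_unique (T : finType) (P : pred T) (z : T) :
  (forall x, P x = (x == z)) -> \sum_x P x = 1.
Proof.
move=> h; rewrite (bigD1 z) //= big1 => [|x /negbTE hx]; first by rewrite h eqxx.
by rewrite h hx.
Qed.

Lemma td_card (K Y T : finType) (f : T -> K -> Y) n : #|Y| = n ->
  (forall i j a b, i != j -> \sum_th ((f th i == a) && (f th j == b)) = 1) ->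
  td K n.
Proof.
move=> <- h; exists T, (fun th i => enum_rank (f th i)) => i j a b ij.
rewrite -(h i j (enum_val a) (enum_val b) ij); apply: eq_bigr => th _.
by rewrite -{1}(enum_valK a) -{1}(enum_valK b) !(inj_eq enum_rank_inj).
Qed.

(** The blocks are affine lines: groups get distinct abscissae [e i], and two points with different
    abscissae determine one line. *)
Lemma td_field (F : finFieldType) (K : finType) : #|K| <= #|F| -> td K #|F|.
Proof.
move=> hK; pose e (i : K) : F := enum_val (widen_ord hK (enum_rank i)).
have e_inj : injective e.
  by move=> i j /enum_val_inj /(congr1 val) /= /ord_inj /enum_rank_inj.
apply: (@td_card K F (F * F)%type (fun th i => th.1 + th.2 * e i)%R) => //.
move=> i j a b ij.
have d0 : (e j - e i != 0)%R by rewrite subr_eq0 (inj_eq e_inj) eq_sym.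
apply: (@sum_unique _ _ (a - (b - a) / (e j - e i) * e i, (b - a) / (e j - e i))%R).
move=> [x y] /=; rewrite xpair_eqE; apply/andP/andP => -[/eqP h1 /eqP h2].
  have hy : (y = (b - a) / (e j - e i))%R.
    by rewrite -h1 -h2 opprD addrACA subrr add0r -mulrBr mulfK.
  by rewrite -hy -h1 addrK !eqxx.
rewrite h1 h2 subrK; split=> //; apply/eqP.
by rewrite -addrA -[(- _ + _)%R]addrC -mulrBr divfK // addrC subrK.
Qed.

Lemma td1 (K : finType) : td K 1.
Proof.
exists unit, (fun _ _ => ord0) => i j a b _; rewrite !ord1 !eqxx.
by apply: (@sum_unique _ _ tt) => -[].
Qed.

Lemma tdM (K : finType) n n' : td K n -> td K n' -> td K (n * n').
Proof.
move=> [T [f hf]] [T' [f' hf']].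
apply: (@td_card K ('I_n * 'I_n')%type (T * T')%type
  (fun th i => (f th.1 i, f' th.2 i))); first by rewrite card_prod !card_ord.
move=> i j [a a'] [b b'] ij.
have := congr2 muln (hf i j a b ij) (hf' i j a' b' ij).
rewrite muln1 big_distrlr /= pair_big /= => <-; apply: eq_bigr => -[th th'] _ /=.
by rewrite !xpair_eqE mulnb; do 4!case: (_ == _).
Qed.

Lemma td_prime_power (K : finType) p d :
  prime p -> 0 < d -> #|K| <= p ^ d -> td K (p ^ d).
Proof.
move=> pp d0; have [F _ <-] := pPrimePowerField pp d0; exact: td_field.
Qed.

(** MacNeish's bound: take the product of the designs over the fields of the prime power factors of
    [n]. *)
Lemma td_logn (K : finType) n : 0 < n ->
  (forall p, p \in primes n -> #|K| <= p ^ logn p n) -> td K n.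
Proof.
move=> n0 h; rewrite (prod_prime_decomp n0) prime_decompE big_map /=.
have: {subset primes n <= primes n} by [].
elim: {1 3}(primes n) => [|p l IH] hl; first by rewrite big_nil; apply: td1.
rewrite big_cons; apply: tdM; last first.
  by apply: IH => q hq; apply: hl; rewrite inE hq orbT.
have hp := hl p (mem_head _ _); have := hp; rewrite mem_primes => /and3P [pp _ dp].
by apply: td_prime_power; rewrite ?h // logn_gt0.
Qed.

Lemma td_big_primes (K : finType) n : 0 < n ->
  (forall p, prime p -> p %| n -> #|K| <= p) -> td K n.
Proof.
move=> n0 h; apply: td_logn => // p hp; have := hp.
rewrite mem_primes => /and3P [pp _ dp]; apply: leq_trans (h p pp dp) _.
by rewrite -{1}(expn1 p) leq_exp2l ?prime_gt1 // logn_gt0.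
Qed.

(** Each block is copied once per block of a transversal design whose groups are its positions. A
    pair lying over an edge of the old block falls in exactly one copy, so both multiplicities are
    kept. *)
Lemma dec_inflate lam (X : finType) (s : X -> X -> nat) n :
  td (star_index lam) n -> dec lam s ->
  dec lam (fun x y : X * 'I_n => s x.1 y.1).
Proof.
move=> [T [f hf]] [l hl].
exists [seq [ffun i => (b i, f th i)] | b : {ffun star_index lam -> X} <- l, th <- enum T].
move=> t [x a] [y c] /=; rewrite big_allpairs_dep -hl; apply: eq_bigr => b _.
rewrite big_enum /= /cov exchange_big /=; apply: eq_bigr => i _.
rewrite exchange_big /=; apply: eq_bigr => j _.
case hij: (incid t i j); last by rewrite big1.
rewrite mul1n; transitivity (\sum_th ((b i == x) && (b j == y)) * ((f th i == a) && (f th j == c))).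
  apply: eq_bigr => th _; rewrite mul1n !ffunE !xpair_eqE mulnb.
  by do 4!case: (_ == _).
by rewrite -big_distrr /= hf ?muln1 // (incid_neq hij).
Qed.

Lemma gdd_mulr lam w g r : td (star_index lam) g ->
  gdd lam w r -> gdd lam (w * g) r.
Proof.
move=> hg /(dec_inflate hg).
have e : #|{: 'I_w * 'I_g}| = w * g by rewrite card_prod !card_ord.
apply: (dec_bij (h := fun p : 'I_r * 'I_w * 'I_g =>
  (p.1.1, cast_ord e (enum_rank (p.1.2, p.2))))) => //.
exists (fun q : 'I_r * 'I_(w * g) => let z := enum_val (cast_ord (esym e) q.2) in (q.1, z.1, z.2)).
  by move=> [[a b] c] /=; rewrite cast_ordK enum_rankK.
by move=> [a b] /=; rewrite -surjective_pairing enum_valK cast_ordKV.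
Qed.

Lemma nestable_gdd_fill lam w r :
  gdd lam w r -> nestable lam w -> nestable lam (r * w).
Proof.
move=> h1 Sn.
apply/(@nestable_card lam ('I_r * 'I_w)%type); first by rewrite card_prod !card_ord.
have h2 : dec lam (fun x y : 'I_r * 'I_w => \sum_(i : 'I_r)
    [&& x \in setX [set i] setT, y \in setX [set i] setT & x != y]).
  apply: dec_sum => i _; apply: nestable_on.
  by rewrite cardsX cards1 cardsT card_ord mul1n.
apply: dec_ext (decD h1 h2) => -[x a] [y c] /=.
case: (eqVneq x y) => [<-|nxy].
  rewrite add0n (bigD1 x) //= !in_setX !inE eqxx /= big1 ?addn0 // => i ix.
  by rewrite !in_setX !inE eq_sym (negbTE ix).
rewrite big1 ?addn0 => [|i _]; first by rewrite xpair_eqE (negbTE nxy).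
rewrite !in_setX !inE; case: (x =P i) => //= <-.
by rewrite eq_sym (negbTE nxy).
Qed.

Lemma nestableM lam f n : td (star_index lam) n ->
  nestable lam f -> nestable lam n -> nestable lam (f * n).
Proof. by move=> hn hf; apply: nestable_gdd_fill; apply: dec_inflate hf. Qed.

(** * Finite fields *)

Lemma big_option (T : finType) (G : option T -> nat) :
  \sum_i G i = G None + \sum_i G (Some i).
Proof.
rewrite (bigD1 None) //=; congr (_ + _).
rewrite (reindex_omap Some id) => [|[i|]] //=.
by apply: eq_bigl => i; rewrite eqxx.
Qed.

Lemma cov_star lam (X : finType) (b : {ffun star_index lam -> X}) x y :
  cov true b x y = \sum_i ((b None == x) && (b (Some i) == y)) +
                   \sum_i ((b (Some i) == x) && (b None == y)).
Proof.
rewrite /cov big_option; congr (_ + _).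
  by rewrite big_option /= mul0n add0n; apply: eq_bigr => i _; rewrite mul1n.
apply: eq_bigr => i _; rewrite big_option /= mul1n big1 ?addn0 //.
Qed.

Lemma cov_clique lam (X : finType) (b : {ffun star_index lam -> X}) x y :
  cov false b x y = \sum_i \sum_(j | j != i)
    ((b (Some i) == x) && (b (Some j) == y)).
Proof.
rewrite /cov big_option big1 ?add0n => [|j _]; last by rewrite mul0n.
apply: eq_bigr => i _; rewrite big_option /= mul0n add0n [RHS]big_mkcond /=.
apply: eq_bigr => j _; rewrite (inj_eq Some_inj) eq_sym.
by case: (j != i); rewrite ?mul1n ?mul0n.
Qed.

Lemma sum_delta (T : finType) (z : T) (P : pred T) :
  \sum_x ((x == z) && P x) = P z.
Proof.
rewrite (bigD1 z) //= eqxx big1 ?addn0 // => x /negbTE -> //.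
Qed.

Lemma finField_prim_root (F : finFieldType) :
  exists g : F, (#|F|.-1).-primitive_root%R g.
Proof.
have q1 : 1 < #|F| by apply: finNzRing_gt1.
pose rs := enum [pred x : F | x != 0%R].
have sz : size rs = #|F|.-1.
  rewrite -cardE (cardD1 (0%R : F)) /= -(cardC1 (0%R : F)).
  by rewrite inE eqxx /= add0n; apply: eq_card => x; rewrite !inE andbb.
have /hasP [g _ hg] : has (#|F|.-1).-primitive_root%R rs.
  apply: has_prim_root; [by lia | | exact: enum_uniq | by rewrite sz].
  apply/allP => x; rewrite mem_enum inE => x0; rewrite unity_rootE.
  rewrite -(inj_eq (mulfI x0)) -exprS mulr1 prednK ?expf_card //; lia.
by exists g.
Qed.

(** With [g] a generator and [e] of order [k], the nonzero elements are the [g^j e^i] and their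
    negatives, for [j < t]. These are the star differences. The leaf differences are
    [g^j e^i (e^u - 1)], so for each nonzero [u] they and their negatives give every nonzero element
    once. *)
Lemma nestable_field lam (F : finFieldType) :
  #|F| = 1 %[mod (lam.*2.+1).*2] -> dec lam (fun x y : F => x != y).
Proof.
set k := lam.*2.+1 => hq.
have q1 : 1 < #|F| by apply: finNzRing_gt1.
have [g hg] := finField_prim_root F.
have [t ht] : exists t, #|F|.-1 = t * k.*2.
  by exists (#|F|.-1 %/ k.*2); rewrite divnK // -subn1 -eqn_mod_dvd ?hq // ltnW.
have t0 : 0 < t by move: q1 ht; case: t => //; lia.
pose e := (g ^+ t.*2)%R.
(* As [k] is odd, [2i + ks] runs over all residues modulo [2k]: its parity gives [s], and then [i]
   follows. *)
pose h (z : 'I_t * 'I_k * bool) : F := (g ^+ (z.1.1 + t * (z.1.2.*2 + k * z.2)))%R.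
have h_inj : injective h.
  move=> [[j i] s] [[j' i'] s'] /eqP; rewrite /h /= (eq_prim_root_expr hg) ht => /eqP E.
  have lt1 (a : 'I_t) (b : 'I_k) (c : bool) : (a + t * (b.*2 + k * c)) %% t = a.
    by rewrite addnC mulnC modnMDl modn_small.
  have ej : j = j' :> nat.
    by rewrite -(lt1 j i s) -(lt1 j' i' s') -(@modn_dvdm (t * k.*2)) ?dvdn_mulr // E modn_dvdm ?dvdn_mulr.
  have {}E : i.*2 + k * s = i'.*2 + k * s' %[mod k.*2].
    apply/eqP; rewrite -(@eqn_pmul2l t) // !muln_modr.
    by have /eqP := E; rewrite -ej eqn_modDl.
  have es : s = s'.
    have : odd ((i.*2 + k * s) %% k.*2) = odd ((i'.*2 + k * s') %% k.*2) by rewrite E.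
    rewrite !odd_mod ?odd_double //.
    by rewrite !oddD !oddM /= !odd_double /=; case: (s); case: (s').
  have ei : i = i' :> nat.
    move: E; rewrite es => /eqP; rewrite eqn_modDr -!mul2n -!muln_modr eqn_pmul2l // => /eqP.
    by rewrite !modn_small.
  by congr (_, _, _); [apply: ord_inj | apply: ord_inj |].
have g0 : (g != 0)%R.
  apply/eqP => E; have /eqP := prim_expr_order hg.
  by rewrite E expr0n gtn_eqF ?(prim_order_gt0 hg) //= eq_sym oner_eq0.
have hN : (g ^+ (t * k) = -1)%R.
  have : ((g ^+ (t * k)) ^+ 2 == 1)%R.
    by rewrite -exprM -mulnA muln2 -ht prim_expr_order.
  rewrite sqrf_eq1 => /orP [|/eqP //].
  by rewrite -(prim_order_dvd hg) ht => /dvdn_leq; rewrite -mul2n; lia.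
have hE z : h z = (g ^+ z.1.1 * e ^+ z.1.2 * (-1) ^+ z.2)%R.
  rewrite /h exprD mulnDr exprD -mulrA; congr (_ * (_ * _))%R.
    by rewrite /e -exprM -doubleMr doubleMl.
  by rewrite mulnA exprM hN.
have ek : (e ^+ k = 1)%R by rewrite /e -exprM -doubleMl doubleMr -ht prim_expr_order.
have e_inj (i i' : 'I_k) : (e ^+ i = e ^+ i')%R -> i = i'.
  move=> E; have : h (Ordinal t0, i, false) = h (Ordinal t0, i', false) by rewrite !hE /= E.
  by move/h_inj => [].
have h1 d : \sum_z (h z == d) = (d != 0%R).
  have hz z : h z != 0%R by rewrite expf_neq0.
  case: eqVneq => [->|d0]; first by rewrite big1 // => z _; rewrite (negbTE (hz z)).
  have /codomP [z ->] : d \in codom h.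
    have sub : codom h \subset [pred x | x != 0%R].
      by apply/subsetP => x /codomP [z ->]; rewrite inE.
    have : codom h =i [pred x | x != 0%R].
      apply/subset_cardP => //; rewrite card_codom // !card_prod !card_ord card_bool.
      rewrite -mulnA muln2 -ht -(cardC1 (0%R : F)).
      by apply: eq_card => x; rewrite !inE.
    by move=> ->; rewrite inE.
  by apply: (@sum_unique _ _ z) => x; rewrite (inj_eq h_inj).
have h2 d : \sum_(j < t) \sum_(i < k) ((g ^+ j * e ^+ i == d)%R + (- (g ^+ j * e ^+ i) == d)%R)
    = (d != 0%R).
  rewrite -h1 pair_big /=.
  transitivity (\sum_(a : 'I_t * 'I_k) \sum_(b : bool) (h (a, b) == d)); last first.
    by rewrite pair_big /=; apply: eq_bigr => -[a b].
  by apply: eq_bigr => a _; rewrite big_bool !hE /= expr1 mulrN1 mulr1 addnC.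
have addE (x y a : F) : ((x + a == y) = (a == y - x))%R.
  by rewrite [RHS]eq_sym subr_eq addrC eq_sym.
pose B (j : 'I_t) (tau : F) : {ffun star_index lam -> F} :=
  [ffun i : star_index lam => if i is Some i' then (tau + g ^+ j * e ^+ i')%R else tau].
exists [seq B j tau | j <- enum 'I_t, tau <- enum F] => -[] x y;
  rewrite big_allpairs_dep big_enum /=.
  rewrite mul1n -subr_eq0 -[RHS]/((x - y != 0)%R : nat) -oppr_eq0 opprB -h2.
  apply: eq_bigr => j _; rewrite big_enum /=.
  under eq_bigr do rewrite cov_star.
  rewrite big_split /= exchange_big [X in _ + X]exchange_big -big_split /=.
  apply: eq_bigr => i _; congr (_ + _).
    under eq_bigr do rewrite !ffunE.
    rewrite (sum_delta x (fun tau => (tau + g ^+ j * e ^+ i == y)%R)).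
    by rewrite addE.
  under eq_bigr do rewrite !ffunE andbC.
  rewrite (sum_delta y (fun tau => (tau + g ^+ j * e ^+ i == x)%R)).
  by rewrite addE -eqr_opp opprB.
pose cl d := \sum_(j < t) \sum_(i < k) \sum_(i' < k | i' != i)
  ((g ^+ j * (e ^+ i' - e ^+ i))%R == d).
transitivity (cl (y - x)%R).
  apply: eq_bigr => j _; rewrite big_enum /=.
  under eq_bigr do rewrite cov_clique.
  rewrite exchange_big /=; apply: eq_bigr => i _.
  rewrite exchange_big /=; apply: eq_bigr => i' _.
  rewrite (eq_bigr (fun tau => ((tau == x - g ^+ j * e ^+ i) && (tau + g ^+ j * e ^+ i' == y))%R : nat)); last first.
    by move=> tau _; rewrite !ffunE addrC addE.
  rewrite (sum_delta _ (fun tau => (tau + g ^+ j * e ^+ i' == y)%R)).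
  by congr nat_of_bool; rewrite -[LHS]subr_eq0 -[RHS]subr_eq0; congr (_ == _); ring.
have clN d : cl (- d)%R = cl d.
  apply: eq_bigr => j _; rewrite (exchange_big_dep predT) //=; apply: eq_bigr => i _.
  apply: eq_big => [i'|i' _]; first by rewrite eq_sym.
  by rewrite -eqr_opp opprK -mulrN opprB.
case: (eqVneq x y) => [->|nxy]; rewrite /= ?muln0 ?muln1.
  rewrite subrr /cl big1 // => j _; rewrite big1 // => i _; rewrite big1 // => i' ii'.
  rewrite mulf_eq0 expf_eq0 (negbTE g0) andbF subr_eq0 /=.
  by case: eqP => // /e_inj E; rewrite E eqxx in ii'.
set d := (y - x)%R; have d0 : d != 0%R by rewrite subr_eq0 eq_sym.
(* Swapping two leaves shows that [cl] is an even function; each of the [2 lam] nonzero exponents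
   [u] contributes one to the sum. *)
suff : cl d + cl (- d)%R = lam.*2 by rewrite clN addnn => /double_inj.
transitivity (\sum_(u < k | u != 0%R) (d != 0%R)); last first.
  by rewrite d0 sum1_card cardC1 card_ord.
rewrite {1 2}/cl -big_split /=.
transitivity (\sum_(u < k | u != 0%R) \sum_(j < t) \sum_(i < k)
   ((g ^+ j * e ^+ i * (e ^+ u - 1) == d)%R + (- (g ^+ j * e ^+ i * (e ^+ u - 1)) == d)%R)).
  rewrite [RHS]exchange_big /=; apply: eq_bigr => j _.
  rewrite [RHS]exchange_big /= -big_split; apply: eq_bigr => i _ /=.
  rewrite -big_split /= (reindex_inj (addrI i)) /=; apply: eq_big => [u|u _].
    by rewrite -{2}(addr0 i) (inj_eq (addrI i)).
  have -> : (e ^+ (i + u)%R = e ^+ i * e ^+ u)%R.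
    by rewrite -exprD /= expr_mod.
  have -> : (g ^+ j * (e ^+ i * e ^+ u - e ^+ i) = g ^+ j * e ^+ i * (e ^+ u - 1))%R by ring.
  by rewrite eqr_oppLR.
apply: eq_bigr => u u0.
have eu : (e ^+ u - 1 != 0)%R.
  by rewrite subr_eq0; apply: contra u0 => /eqP E; apply/eqP/e_inj; rewrite E expr0.
have -> : (d != 0%R) = (d / (e ^+ u - 1) != 0)%R.
  by rewrite mulf_eq0 invr_eq0 (negbTE eu) orbF.
rewrite -h2; apply: eq_bigr => j _; apply: eq_bigr => i _.
by rewrite !(eq_sym _ (d / _)%R) !(can2_eq (divfK eu) (mulfK eu)) mulNr !(eq_sym d).
Qed.

(** * Linear functionals on finite fields *)

(** The functional is a coordinate in a basis over ['F_p], chosen not to vanish at 1. *)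
Lemma prime_power_field p d : prime p -> 0 < d ->
  exists (F : finFieldType) (l : {additive F -> 'F_p}),
    [/\ #|F| = p ^ d, p \in [pchar F]%R & exists a, l a != 0%R].
Proof.
move=> pp d0; have [F cF hF] := pPrimePowerField pp d0.
pose V := pPrimeCharType cF.
pose e := vbasis {: V}.
have [i hi] : exists i, (coord e i (1%R : V) != 0)%R.
  case: (pickP (fun i => coord e i (1%R : V) != 0)%R) => [i hi|h]; first by exists i.
  have := oner_neq0 V; rewrite (coord_vbasis (memvf (1%R : V))) big1 ?eqxx // => i _.
  by have /negbFE /eqP -> := h i; rewrite scale0r.
pose l (a : F) : 'F_p := coord e i (a : V).
have lB : {morph l : x y / (x - y)%R} by move=> x y; apply: (linearB (coord e i)).
pose lA : {additive F -> 'F_p} := HB.pack l (GRing.isZmodMorphism.Build _ _ l lB).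
exists F, lA.
by split=> //; exists 1%R.
Qed.

Local Open Scope ring_scope.

Lemma natr_Fp_mul p (a b : 'F_p) : prime p -> b *+ (a : nat) = a * b.
Proof. by move=> pp; rewrite -mulr_natl natr_Zp. Qed.

(** The pairing [l (x * y)] is nondegenerate, so elements independent over ['F_p] give independent
    functionals, which take arbitrary joint values. *)
Lemma additive_interpolation p (F : finFieldType) (l : {additive F -> 'F_p})
    (T : finType) (g : T -> F) (c : T -> 'F_p) :
  prime p -> (exists a, l a != 0) ->
  (forall e : T -> 'F_p, \sum_i g i *+ (e i : nat) = 0 -> forall i, e i = 0) ->
  exists a, forall i, l (g i * a) = c i.
Proof.
move=> pp [a0 la0] gfree.
pose M := \matrix_(x < #|F|, i < #|T|) l (g (enum_val i) * enum_val x) : 'M['F_p]_(#|F|, #|T|).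
have fM : row_full M.
  rewrite /row_full -mxrank_tr; apply: inj_row_free => v hv; apply/rowP => j; rewrite mxE.
  rewrite -(enum_valK j); apply: (gfree (fun i => v 0 (enum_rank i))).
  set s := \sum_i _; case: (eqVneq s 0) => // s0.
  case/negP: la0; apply/eqP.
  (* Evaluating the dependency at [s^-1 * a0] would force [l a0 = 0]. *)
  have -> : a0 = \sum_i (g i * (s^-1 * a0)) *+ (v 0 (enum_rank i) : nat).
    transitivity (s * (s^-1 * a0)); first by rewrite mulVKf.
    by rewrite /s mulr_suml; apply: eq_bigr => i _; rewrite mulrnAl.
  have := congr1 (fun A : 'rV_ _ => A 0 (enum_rank (s^-1 * a0))) hv.
  rewrite !mxE raddf_sum /= => E; rewrite -[RHS]E [RHS](reindex _ (onW_bij _ (enum_rank_bij T))) /=.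
  apply: eq_bigr => i _.
  by rewrite !mxE !enum_rankK raddfMn /= natr_Fp_mul.
have /submxP [u hu] := submx_full (\row_i c (enum_val i)) fM.
exists (\sum_x enum_val x *+ (u 0 x : nat)) => i.
have := congr1 (fun A : 'rV_ _ => A 0 (enum_rank i)) hu; rewrite /= !mxE enum_rankK => ->.
rewrite mulr_sumr raddf_sum; apply: eq_bigr => x _.
by rewrite mxE enum_rankK mulrnAr raddfMn /= natr_Fp_mul.
Qed.

(** Since the inverse of zero is zero, a repeated node would give a nontrivial relation with a
    single term. *)
Lemma generic_nodes_inj p (F : finFieldType) r (m : nat -> F) :
  (forall y, (y < r)%N -> forall e : 'I_y -> 'F_p,
    \sum_(x < y) (m y - m x)^-1 *+ (e x : nat) = 0 -> forall x, e x = 0) ->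
  forall x y, (x < y)%N -> (y < r)%N -> m x != m y.
Proof.
move=> hm x y xy yr; apply/eqP => E.
pose e (z : 'I_y) : 'F_p := if z == Ordinal xy then 1 else 0.
suff H : \sum_(x < y) (m y - m x)^-1 *+ (e x : nat) = 0.
  by have /eqP := hm y yr e H (Ordinal xy); rewrite /e eqxx oner_eq0.
rewrite big1 // => z _; rewrite /e.
case: eqP => [->|_] /=; last by rewrite mulr0n.
by rewrite E subrr invr0 mul0rn.
Qed.

(* Greedy choice: a new node must avoid the roots of fewer than p^r polynomials
   of degree less than r. *)
Lemma generic_nodes p (F : finFieldType) r : prime p -> p \in [pchar F] ->
  ((r + 3 + p ^ r * r.+1)%N <= #|F|)%N ->
  exists m : nat -> F, forall y, (y < r)%N -> forall e : 'I_y -> 'F_p,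
    \sum_(x < y) (m y - m x)^-1 *+ (e x : nat) = 0 -> forall x, e x = 0.
Proof.
move=> pp cF; elim: r => [|r IH] hF; first by exists (fun _ => 0).
have [|m hm] := IH.
  apply: leq_trans hF; rewrite !leq_add // leq_mul // leq_exp2l ?prime_gt1 //.
have m_inj := generic_nodes_inj hm.
(* [P e] is the numerator of the sum of the fractions [e x / (X - m x)]. Only the term of [x]
   survives at [m x], so [P e] is nonzero when [e] is. *)
pose Q (x : 'I_r) : {poly F} := \prod_(z < r | z != x) ('X - (m z)%:P).
pose P (e : {ffun 'I_r -> 'F_p}) : {poly F} := \sum_x Q x *+ (e x : nat).
have Q0 (x z : 'I_r) : x != z -> (Q z).[m x] = 0.
  by move=> xz; rewrite horner_prod (bigD1 x) //= hornerXsubC subrr mul0r.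
have Qn (x : 'I_r) : (Q x).[m x] != 0.
  rewrite horner_prod; apply/prodf_neq0 => z zx; rewrite hornerXsubC subr_eq0.
  have [xz|zx'|E] := ltngtP x z; [exact: m_inj | by rewrite eq_sym m_inj | ].
  by rewrite (ord_inj E) eqxx in zx.
have natF (c : 'F_p) : c != 0 -> (c : nat)%:R != 0 :> F.
  move=> c0; rewrite -(dvdn_pcharf cF) gtnNdvd //; first by rewrite lt0n.
  by have := ltn_ord c; rewrite [X in (_ < X)%N]Fp_cast.
have Pn (e : {ffun 'I_r -> 'F_p}) : e != 0 -> P e != 0.
  move=> e0; have [x hx] : exists x, e x != 0.
    apply/existsP; apply: contraR e0; rewrite negb_exists => /forallP h.
    by apply/eqP/ffunP => x; rewrite ffunE; apply/eqP; have := h x; rewrite negbK.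
  apply/eqP => /(congr1 (fun q : {poly F} => q.[m x])); rewrite horner0 /P horner_sum.
  rewrite (bigD1 x) //= big1 => [|z zx]; last by rewrite hornerMn Q0 1?eq_sym // mul0rn.
  rewrite addr0 hornerMn -mulr_natr => /eqP; rewrite mulf_eq0 (negbTE (Qn x)) /=.
  by apply/negP/natF.
pose b1 : {poly F} := \prod_(x < r) ('X - (m x)%:P).
pose b2 : {poly F} := \prod_(e : {ffun 'I_r -> 'F_p} | e != 0) P e.
(* A non-root of [big] differs from the old nodes and satisfies no nontrivial relation. *)
pose big := b1 * b2.
have bign : big != 0.
  rewrite mulf_neq0 //; last by apply/prodf_neq0 => e; apply: Pn.
  by apply/prodf_neq0 => x _; rewrite polyXsubC_eq0.
have szbig : (size big <= #|F|)%N.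
  apply: leq_trans hF; apply: leq_trans (size_polyMleq _ _) _.
  have : (size b1 <= r + 1)%N.
    rewrite size_prod => [|x _]; last by rewrite polyXsubC_eq0.
    under eq_bigr do rewrite size_XsubC.
    by rewrite sum_nat_const card_ord; lia.
  have sP e : (size (P e) <= r)%N.
    rewrite /P; apply: leq_trans (size_sum _ _ _) _; apply/bigmax_leqP => x _.
    rewrite -scaler_nat; apply: leq_trans (size_scale_leq _ _) _.
    rewrite size_prod => [|z _]; last by rewrite polyXsubC_eq0.
    under eq_bigr do rewrite size_XsubC.
    by rewrite sum_nat_const cardC1 card_ord; have := ltn_ord x; lia.
  have : (size b2 <= p ^ r * r + 1)%N.
    apply: leq_trans (size_poly_prod_leq _ _) _.
    apply: leq_trans (leq_subr _ _) _; rewrite addn1 ltnS.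
    apply: leq_trans (leq_sum _ (fun e _ => sP e)) _.
    rewrite sum_nat_const leq_mul2r; apply/orP; right.
    apply: leq_trans (max_card _) _.
    by rewrite card_ffun card_Fp // card_ord.
  have : (p ^ r * r <= p ^ r.+1 * r.+2)%N.
    by rewrite leq_mul // ?leq_exp2l ?prime_gt1 //; lia.
  move: (size b1) (size b2) => a b.
  by move: (p ^ r * r)%N (p ^ r.+1 * r.+2)%N => c d; lia.
have [z hz] : exists z, ~~ root big z.
  apply/existsP; apply: contraLR szbig; rewrite negb_exists -ltnNge => /forallP h.
  rewrite cardE; apply: max_poly_roots => //; last exact: enum_uniq.
  by apply/allP => z _; have := h z; rewrite negbK.
move: hz; rewrite /root hornerM mulf_eq0 negb_or !horner_prod => /andP [h1 h2].
exists (fun i => if (i < r)%N then m i else z) => y yr e.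
have [yr'|ry] := ltnP y r.
  rewrite (eq_bigr (fun x : 'I_y => (m y - m x)^-1 *+ (e x : nat))); first exact: hm.
  by move=> x _; rewrite (ltn_trans (ltn_ord x) yr').
have ey : y = r by lia.
subst y => E; pose e' := [ffun x => e x].
suff : e' = 0 by move/ffunP => E' x; have := E' x; rewrite !ffunE.
apply/eqP; apply: contraTT isT => e0.
have zm (x : 'I_r) : z - m x != 0.
  by have /prodf_neq0 /(_ x isT) := h1; rewrite hornerXsubC.
have /prodf_neq0 /(_ e' e0) := h2; rewrite /P horner_sum; case/negP; apply/eqP.
transitivity (\prod_(x < r) (z - m x) * \sum_(x < r) (z - m x)^-1 *+ (e x : nat)).
  rewrite mulr_sumr; apply: eq_bigr => x _; rewrite ffunE hornerMn mulrnAr; congr (_ *+ _).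
  rewrite (bigD1 x) //= mulrAC divff // mul1r horner_prod.
  by apply: eq_bigr => i _; rewrite hornerXsubC.
rewrite [X in _ * X](_ : _ = 0) ?mulr0 // -[RHS]E; apply: eq_bigr => x _.
by rewrite ltn_ord.
Qed.

Local Close Scope ring_scope.

(** * Reducing the index by a prime *)

(** Vertices are added one at a time: the new value must have prescribed images under [l] after
    multiplication by each [(m n - m x)^-1], and these are independent by the choice of nodes. *)
Lemma exists_potential p (F : finFieldType) (l : {additive F -> 'F_p})
    (m : nat -> F) (r : nat) (C : nat -> nat -> 'F_p) :
  prime p -> (exists a, l a != 0%R) ->
  (forall y, y < r -> forall e : 'I_y -> 'F_p,
    (\sum_(x < y) (m y - m x)^-1 *+ (e x : nat) = 0)%R -> forall x, e x = 0%R) ->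
  exists A : nat -> F, forall x y, x < y -> y < r ->
    l ((A y - A x) / (m y - m x))%R = C x y.
Proof.
move=> pp l0 hm.
suff H n : n <= r -> exists A : nat -> F, forall x y, x < y -> y < n ->
    l ((A y - A x) / (m y - m x))%R = C x y by apply: (H r).
elim: n => [|n IH] nr; first by exists (fun=> 0%R).
have [A hA] := IH (ltnW nr).
have [a ha] := @additive_interpolation p F l 'I_n (fun x => (m n - m x)^-1)%R
  (fun x => C x n + l ((m n - m x)^-1 * A x))%R pp l0 (hm n nr).
exists (fun i => if i == n then a else A i) => x y xy yn.
have -> : (x == n) = false by apply/negbTE; lia.
case: eqP => [->|yn']; last by apply: hA => //; lia.
have xn : x < n by lia.
rewrite mulrC mulrBr raddfB (ha (Ordinal xn)) /=; ring.
Qed.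

(** This is the equitable colouring by position modulo [p], to be applied to the blocks through a
    pair. *)
Lemma count_index_mod (T : eqType) (l : seq T) p n c : uniq l -> c < p ->
  size l = p * n -> count (fun z => index z l %% p == c) l = n.
Proof.
move=> ul cp sl.
have -> : count (fun z => index z l %% p == c) l = count (fun i => i %% p == c) (iota 0 (p * n)).
  rewrite -sl -(count_map (index^~ l) (fun i => i %% p == c)); congr count.
  case: l ul {sl} => // x0 l ul.
  apply: (@eq_from_nth _ 0) => [|i]; rewrite size_map ?size_iota // => hi.
  by rewrite (nth_map x0) // nth_iota // index_uniq.
elim: n {sl} => [|n IH]; first by rewrite muln0.
rewrite mulnS addnC iotaD count_cat IH add0n -addn1; congr (_ + _).
rewrite -[X in iota X _]addn0 iotaDl count_map.
rewrite (eq_in_count (a2 := pred1 c)); first by rewrite (count_uniq_mem _ (iota_uniq _ _)) mem_iota /= cp.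
by move=> i; rewrite mem_iota /= add0n => hi; rewrite mulnC modnMDl modn_small.
Qed.

Lemma cov_inj lam (X : finType) t (b : {ffun star_index lam -> X}) i j :
  injective b -> cov t b (b i) (b j) = incid t i j.
Proof.
move=> bi; rewrite /cov (bigD1 i) //= (bigD1 j) //= !eqxx muln1.
rewrite big1 => [|j' /negbTE hj]; last by rewrite (inj_eq bi _ j) hj andbF muln0.
rewrite big1 ?addn0 // => i' /negbTE hi; rewrite big1 // => j' _.
by rewrite (inj_eq bi i') hi muln0.
Qed.

Lemma cov_gt0 lam (X : finType) t (b : {ffun star_index lam -> X}) x y :
  0 < cov t b x y -> exists i j, [/\ incid t i j, x = b i & y = b j].
Proof.
rewrite lt0n; case: (pickP (fun z : star_index lam * star_index lam =>
  [&& incid t z.1 z.2, b z.1 == x & b z.2 == y])) => [[i j] /and3P [h /eqP <- /eqP <-] _|h].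
  by exists i, j.
case/negP; apply/eqP; rewrite /cov big1 // => i _; rewrite big1 // => j _.
by have /= := h (i, j); case: (incid t i j) => //= ->.
Qed.

Lemma incid_excl lam (i j : star_index lam) : incid false i j -> ~~ incid true i j.
Proof. by rewrite /incid; case: (i == None); case: (j == None). Qed.

Lemma incid_total lam (i j : star_index lam) : i != j -> exists t, incid t i j.
Proof.
case: i j => [i|] [j|] // h; [by exists false; rewrite /incid h | by exists true..].
Qed.

Lemma dec_blocks_inj lam (X : finType) (s : X -> X -> nat)
    (l : seq {ffun star_index lam -> X}) :
  (forall x, s x x = 0) ->
  (forall t x y, \sum_(b <- l) cov t b x y = mult lam t * s x y) ->
  forall b, b \in l -> injective b.
Proof.
move=> s0 hl b bl i j E; apply/eqP; apply: contraT => /incid_total [t ht].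
have := hl t (b i) (b i); rewrite s0 muln0 (big_rem b) //= => /eqP.
rewrite addn_eq0 => /andP [/eqP h _]; move: h.
rewrite /cov (bigD1 i) //= (bigD1 j) //= ht E !eqxx; lia.
Qed.

(* The block [b], potential [P] and [th] in the kernel of [l] give the blocks
   i |-> (b i, P (b i) + mu (b i) * th + tau); the pair ((x, a), (y, c)) is covered
   exactly by the blocks on {x, y} of colour l ((c - a) / (mu y - mu x)). *)
Lemma dec_lift lam (X : finType) (s : X -> X -> nat) p : prime p ->
  (forall x, s x x = 0) -> dec lam (fun x y => p * s x y) ->
  exists d0, forall d, d0 <= d -> dec lam (fun x y : X * 'I_(p ^ d) => s x.1 y.1).
Proof.
move=> pp s0 [sl hsl]; pose r := #|X|.
exists (r + 3 + p ^ r * r.+1) => d hd.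
have d0 : 0 < d by lia.
have [F [l [cF chF l0]]] := prime_power_field pp d0.
have [m hm] := @generic_nodes p F r pp chF
  (leq_trans hd (leq_trans (ltnW (ltn_expl _ (prime_gt1 pp))) (eq_leq (esym cF)))).
pose n := size sl.
pose b (q : 'I_n) := tnth (in_tuple sl) q.
have b_inj q : injective (b q).
  apply: (@dec_blocks_inj lam X (fun x y => p * s x y) sl) => //; last exact: mem_tnth.
  by move=> x; rewrite s0 muln0.
have hb t x y : \sum_q cov t (b q) x y = mult lam t * (p * s x y).
  by rewrite -hsl [RHS]big_tnth.
pose A t x y := [set q | 0 < cov t (b q) x y].
have AC t x y : A t x y = A t y x by apply/setP => q; rewrite !inE covC.
(* A block covers a pair by a star edge or by a leaf pair, never both. The test selects the list in
   which the block is ranked, so the colour is independent of [t]. *)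
pose pos q x y := index q (enum (A (0 < cov true (b q) x y) x y)).
pose col q x y : 'F_p := ((pos q x y)%:R)%R.
have colC q x y : col q x y = col q y x by rewrite /col /pos AC covC.
have colP t x y (c : 'F_p) :
    \sum_q cov t (b q) x y * (col q x y == c) = mult lam t * s x y.
  have covA q : cov t (b q) x y = (q \in A t x y).
    rewrite inE; case: posnP => [//|/cov_gt0 [i [j [h -> ->]]]].
    by rewrite cov_inj // h.
  have -> : \sum_q cov t (b q) x y * (col q x y == c)
      = \sum_(q in A t x y) (index q (enum (A t x y)) %% p == c).
    rewrite [RHS]big_mkcond; apply: eq_bigr => q _; rewrite covA.
    case: ifP => // qA; rewrite mul1n /col /pos.
    have -> : (0 < cov true (b q) x y) = t.
      case: t covA qA => covA; rewrite inE // => /cov_gt0 [i [j [h -> ->]]].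
      by rewrite cov_inj // (negbTE (incid_excl h)).
    by congr nat_of_bool; apply/eqP/eqP => [<-|h]; [|apply: val_inj => /=]; rewrite ?h val_Fp_nat.
  transitivity (count (fun q => index q (enum (A t x y)) %% p == c) (enum (A t x y))).
    rewrite -big_enum -sum1_count [RHS]big_mkcond /=.
    by apply: eq_bigr => q _; case: (_ == _).
  apply: count_index_mod; [exact: enum_uniq | |].
    by have := ltn_ord c; rewrite [X in (_ < X)%N]Fp_cast.
  rewrite -cardE mulnCA -hb -sum1_card big_mkcond /=; apply: eq_bigr => q _.
  by rewrite covA; case: (_ \in _).
pose rk (x : X) : nat := enum_rank x.
pose mu x := m (rk x).
have rk_inj : injective rk by move=> x y /ord_inj /enum_rank_inj.
have hpot q : exists P : X -> F, forall x y, x != y ->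
    l ((P y - P x) / (mu y - mu x))%R = col q x y.
  pose C i j := match [pick x | rk x == i], [pick y | rk y == j] with
    Some x, Some y => col q x y | _, _ => 0%R end.
  have CE x y : C (rk x) (rk y) = col q x y.
    rewrite /C; case: pickP => [x' /eqP /rk_inj ->|/(_ x)]; last by rewrite eqxx.
    by case: pickP => [y' /eqP /rk_inj ->|/(_ y)] //; rewrite eqxx.
  have [P hP] := exists_potential C pp l0 hm.
  exists (fun x => P (rk x)) => x y xy.
  have [lt|gt|E] := ltngtP (rk x) (rk y).
  - by rewrite -CE; apply: hP => //; apply: ltn_ord.
  - rewrite colC -CE -hP ?ltn_ord //; congr (l _); rewrite /mu.
    by rewrite -[LHS]mulrNN -invrN !opprB.
  - by rewrite (rk_inj _ _ E) eqxx in xy.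
have [P hP] := fin_all_exists hpot.
have mu_inj x y : x != y -> (mu y - mu x != 0)%R.
  move=> xy; rewrite subr_eq0 /mu.
  have [lt|gt|E] := ltngtP (rk x) (rk y).
  - by rewrite eq_sym; apply: (generic_nodes_inj hm) => //; apply: ltn_ord.
  - by apply: (generic_nodes_inj hm) => //; apply: ltn_ord.
  - by rewrite (rk_inj _ _ E) eqxx in xy.
pose B (q : 'I_n) (z : F * F) : {ffun star_index lam -> X * F} :=
  [ffun i => (b q i, P q (b q i) + mu (b q i) * z.1 + z.2)%R].
suff H : dec lam (fun x y : X * F => s x.1 y.1).
  pose h (z : X * F) : X * 'I_(p ^ d) := (z.1, cast_ord cF (enum_rank z.2)).
  apply: (dec_bij (h := h)) H => //.
  exists (fun z => (z.1, enum_val (cast_ord (esym cF) z.2))).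
    by move=> [x a]; rewrite /h /= cast_ordK enum_rankK.
  by move=> [x a]; rewrite /h /= enum_valK cast_ordKV.
exists [seq B q z | q <- enum 'I_n, z <- enum [pred z : F * F | l z.1 == 0%R]].
move=> t [x a] [y c]; rewrite big_allpairs_dep big_enum /=.
pose k := l ((c - a) / (mu y - mu x))%R.
rewrite -(colP t x y k); apply: eq_bigr => q _; rewrite big_enum /=.
pose R (z : F * F) := ((P q x + mu x * z.1 + z.2 == a) && (P q y + mu y * z.1 + z.2 == c))%R.
transitivity (\sum_(z | l z.1 == 0%R) cov t (b q) x y * R z).
  apply: eq_bigr => z _; rewrite /cov big_distrl; apply: eq_bigr => i _.
  rewrite big_distrl; apply: eq_bigr => j _ /=; rewrite !ffunE !xpair_eqE !mulnb.
  congr nat_of_bool; case: (incid t i j) => //=.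
  case: (b q i =P x) => [->|_] //=; case: (b q j =P y) => [->|_] //=.
  by rewrite andbF.
rewrite -big_distrr /=.
case: (eqVneq x y) => [E|xy].
  suff -> : cov t (b q) x y = 0 by [].
  apply/eqP; apply: contraT; rewrite -lt0n => /cov_gt0 [i [j [h Ei Ej]]].
  have /b_inj E' : b q i = b q j by rewrite -Ei -Ej.
  by rewrite E' incidii in h.
congr (_ * _); have D := mu_inj x y xy.
(* [t0] is the only parameter for which a lift of the block meets both [(x, a)] and [(y, c)];
   [l t0 = 0] means that the block gives the pair the colour [k]. *)
pose t0 := ((c - a - (P q y - P q x)) / (mu y - mu x))%R.
rewrite big_mkcond (eq_bigr (fun z => (z == (t0, a - P q x - mu x * t0)%R) && (l z.1 == 0%R) : nat)).
  rewrite (sum_delta _ (fun z => l z.1 == 0%R)) /=; congr nat_of_bool.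
  by rewrite /t0 mulrBl raddfB subr_eq0 hP // eq_sym.
move=> [th tau] _ /=; rewrite [in RHS]andbC; case: (l th == 0%R) => //=.
congr nat_of_bool; rewrite /R xpair_eqE /=; apply/andP/andP => -[/eqP E1 /eqP E2].
  have Et : th = t0.
    by rewrite /t0 -E1 -E2; apply: (mulIf D); rewrite divfK //; ring.
  by rewrite -Et -E1; split=> //; apply/eqP; ring.
rewrite E2 E1; split; apply/eqP; first by ring.
have -> : c = ((mu y - mu x) * t0 + a + (P q y - P q x))%R.
  by rewrite /t0 mulrC divfK //; ring.
ring.
Qed.

(** The prime factors of the index are removed one by one, each costing a factor [p ^ d] in the
    number of points; [Q] is a multiplicative property wanted of the total cost. *)
Lemma dec_lift_iter lam (Q : nat -> Prop) : Q 1 ->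
  (forall a b, Q a -> Q b -> Q (a * b)) ->
  forall N, 0 < N ->
  (forall p, prime p -> p %| N -> forall d0, exists2 d, d0 <= d & Q (p ^ d)) ->
  forall (X : finType) (s : X -> X -> nat), (forall x, s x x = 0) ->
  dec lam (fun x y => N * s x y) ->
  exists2 q, Q q & dec lam (fun x y : X * 'I_q => s x.1 y.1).
Proof.
move=> Q1 QM N; have [n] := ubnP N; elim: n N => // n IH N /ltnSE hN N0 hQ X s s0 hd.
have [N1|N1] := leqP N 1.
  exists 1 => //; have {N1} EN : N = 1 by lia.
  apply: (dec_bij (h := fun x : X => (x, ord0 : 'I_1))) hd => [|x y]; last by rewrite EN mul1n.
  by exists fst => // -[x a]; rewrite (ord1 a).
have pp := pdiv_prime N1; have pd := pdiv_dvd N.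
pose N' := N %/ pdiv N.
have EN : N = pdiv N * N' by rewrite mulnC divnK.
have hd' : dec lam (fun x y => pdiv N * (N' * s x y)).
  by apply: dec_ext hd => x y; rewrite mulnA -EN.
have [|d0 hd0] := dec_lift pp _ hd'; first by move=> x; rewrite s0 muln0.
have [d dd0 Qd] := hQ _ pp pd d0.
have N'0 : 0 < N' by rewrite divn_gt0 ?pdiv_gt0 // dvdn_leq.
have lN : N' < n by apply: leq_trans hN; apply: ltn_Pdiv => //; apply: prime_gt1.
have hQ' p : prime p -> p %| N' -> forall d0, exists2 d, d0 <= d & Q (p ^ d).
  by move=> p0 pN; apply: hQ => //; rewrite EN dvdn_mull.
have [q Qq hq] := IH N' lN N'0 hQ' _ (fun x y : X * 'I_(pdiv N ^ d) => s x.1 y.1)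
  (fun x => s0 x.1) (hd0 d dd0).
exists (pdiv N ^ d * q); first exact: QM.
have e : #|{: 'I_(pdiv N ^ d) * 'I_q}| = pdiv N ^ d * q by rewrite card_prod !card_ord.
apply: (dec_bij (h := fun z : X * 'I_(pdiv N ^ d) * 'I_q =>
  (z.1.1, cast_ord e (enum_rank (z.1.2, z.2))))) hq => //.
exists (fun z : X * 'I_(pdiv N ^ d * q) => let a := enum_val (cast_ord (esym e) z.2) in (z.1, a.1, a.2)).
  by move=> [[a b] c] /=; rewrite cast_ordK enum_rankK.
by move=> [a b] /=; rewrite -surjective_pairing enum_valK cast_ordKV.
Qed.

(** * Averaging over the symmetric group *)

Lemma perm_2transitive (T : finType) (u v x y : T) : u != v -> x != y ->
  exists s : {perm T}, s u = x /\ s v = y.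
Proof.
move=> uv xy; pose s1 := tperm u x.
have hv : s1 v != x by rewrite -[X in _ != X](tpermL u x) (inj_eq perm_inj) eq_sym.
exists (s1 * tperm (s1 v) y)%g; split; rewrite permM ?tpermL //.
by rewrite tpermD // eq_sym.
Qed.

Lemma perm_pair_count (T : finType) : exists n : nat, forall u v x y : T,
  u != v -> x != y -> 0 < n /\ \sum_(s : {perm T}) ((s u == x) && (s v == y)) = n.
Proof.
case: (pickP (fun z : T * T => z.1 != z.2)) => [[u0 v0] /= h0|h]; last first.
  by exists 0 => u v x y uv; have := h (u, v); rewrite /= uv.
exists (\sum_(s : {perm T}) ((s u0 == u0) && (s v0 == v0))) => u v x y uv xy.
split; first by rewrite (bigD1 1%g) //= !perm1 !eqxx.
have [r [ru rv]] := perm_2transitive h0 uv.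
have [s [sx sy]] := perm_2transitive xy h0.
rewrite [RHS](reindex_inj (h := fun p => (r * p * s)%g)) /=; last by move=> p q /mulIg /mulgI.
by apply: eq_bigr => p _; rewrite !permM ru rv -sx -sy !(inj_eq perm_inj).
Qed.

(** There are [k] star edges and [k (k - 1) / 2 = lam k] leaf pairs, each in two orders. The ratio 1
    to [lam] is what lets the images of a block add up to a uniform vector. *)
Lemma sum_incid lam t :
  \sum_(i : star_index lam) \sum_(j : star_index lam) (incid t i j : nat) =
  mult lam t * (lam.*2.+1).*2.
Proof.
case: t; rewrite big_option.
  rewrite big_option /= add0n sum_nat_const card_ord muln1.
  under eq_bigr do rewrite big_option big1 // addn0.
  by rewrite sum_nat_const card_ord muln1 mul1n addnn.
rewrite big1 // add0n.
under eq_bigr => i _.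
  rewrite big_option /= add0n.
  have -> : \sum_j (incid false (Some i) (Some j) : nat) = lam.*2.
    rewrite -[RHS]/(lam.*2.+1.-1) -[in RHS](card_ord lam.*2.+1) -(cardC1 i) -sum1_card [RHS]big_mkcond.
    by apply: eq_bigr => j _; rewrite /incid /= (inj_eq Some_inj) eq_sym !inE; case: (j == i).
  over.
by rewrite sum_nat_const card_ord /mult; lia.
Qed.

(** * Alternating 4-cycles *)

Local Open Scope ring_scope.

Definition edge (X : eqType) (a b x y : X) : int :=
  ((a == x) && (b == y))%:R + ((b == x) && (a == y))%:R.

(** The 4-cycle through [a], [b], [c], [d] in this order, with alternating signs. *)
Definition quad (X : eqType) (a b c d x y : X) : int :=
  edge a b x y - edge c b x y - edge a d x y + edge c d x y.

Lemma edgeC (X : eqType) (a b x y : X) : edge a b x y = edge a b y x.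
Proof. by rewrite /edge addrC andbC [in X in _ + X]andbC. Qed.

Lemma sum_edge (X : finType) (a b x : X) :
  \sum_y edge a b x y = (a == x)%:R + (b == x)%:R.
Proof.
rewrite /edge big_split /=; congr (_ + _).
  rewrite (bigD1 b) //= eqxx andbT big1 ?addr0 // => y /negbTE h.
  by rewrite (eq_sym b) h andbF.
rewrite (bigD1 a) //= eqxx andbT big1 ?addr0 // => y /negbTE h.
by rewrite (eq_sym a) h andbF.
Qed.

Lemma sum_quad (X : finType) (a b c d x : X) : \sum_y quad a b c d x y = 0.
Proof. by rewrite /quad big_split /= big_split /= big_split /= !sumrN !sum_edge; ring. Qed.

Lemma quadC (X : eqType) (a b c d x y : X) : quad a b c d x y = quad a b c d y x.
Proof. by rewrite /quad edgeC (edgeC c b) (edgeC a d) (edgeC c d). Qed.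

Lemma quadxx (X : eqType) (a b c d x : X) : uniq [:: a; b; c; d] ->
  quad a b c d x x = 0.
Proof.
rewrite /= !inE !negb_or -!andbA => /and4P [ab ac ad /and4P [bc bd cd _]].
have E (p q : X) : p != q -> edge p q x x = 0.
  move=> pq; rewrite /edge; case: (eqVneq p x) => [Ep|] /=; last by rewrite andbF.
  by rewrite -Ep eq_sym (negbTE pq).
by rewrite /quad !E // eq_sym.
Qed.

Lemma edge0 (X : eqType) (a b x y : X) :
  ~~ ((a == x) && (b == y)) -> ~~ ((b == x) && (a == y)) -> edge a b x y = 0.
Proof. by rewrite /edge => /negbTE -> /negbTE ->. Qed.

Lemma edge1 (X : eqType) (a b : X) : a != b -> edge a b a b = 1.
Proof. by move=> /negbTE h; rewrite /edge !eqxx eq_sym h. Qed.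

Definition zero_degree (r : nat) (e : 'I_r -> 'I_r -> int) : Prop :=
  [/\ forall x y, e x y = e y x, forall x, e x x = 0 & forall x, \sum_y e x y = 0].

Lemma zero_degreeB r (e : 'I_r -> 'I_r -> int) (z : int) a b c d :
  uniq [:: a; b; c; d] -> zero_degree e ->
  zero_degree (fun x y => e x y - z * quad a b c d x y).
Proof.
move=> u [h1 h2 h3]; split=> [x y|x|x]; first by rewrite h1 quadC.
  by rewrite h2 quadxx // mulr0 subr0.
by rewrite big_split /= sumrN -mulr_sumr sum_quad h3 mulr0 subr0.
Qed.

(* The edges are eliminated in decreasing lexicographic order of their endpoints. *)
Lemma quad_generation r (P : ('I_r -> 'I_r -> int) -> Prop) : (3 < r)%N ->
  (forall e1 e2, (forall x y, e1 x y = e2 x y) -> P e1 -> P e2) ->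
  P (fun _ _ => 0) ->
  (forall e z a b c d, uniq [:: a; b; c; d] ->
     P e -> P (fun x y => e x y + z * quad a b c d x y)) ->
  forall e, zero_degree e -> P e.
Proof.
move=> r3 Pext P0 Pq.
have Pq' e z a b c d : uniq [:: a; b; c; d] ->
    P (fun x y => e x y - z * quad a b c d x y) -> P e.
  by move=> u /(Pq _ z a b c d u); apply: Pext => x y; rewrite subrK.
(* The support of [e] lies on edges whose larger endpoint is below [y], or equals [y] with the other
   endpoint below [j]. *)
pose sup (y j : nat) (e : 'I_r -> 'I_r -> int) := forall x z : 'I_r,
  [|| (y < x)%N, (y < z)%N, (x == y :> nat) && (j <= z)%N | (z == y :> nat) && (j <= x)%N] ->
  e x z = 0.
pose C y j := forall e, zero_degree e -> sup y j e -> P e.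
have r0 : (0 < r)%N by lia.
have r1 : (1 < r)%N by lia.
have r2 : (2 < r)%N by lia.
pose o0 := Ordinal r0; pose o1 := Ordinal r1; pose o2 := Ordinal r2.
have ordE (x y : 'I_r) : (x == y) = (x == y :> nat) by rewrite -val_eqE.
(* On three vertices the degree equations force all edges to vanish. *)
have C2 j : C 2%N j.
  move=> e [h1 h2 h3] hs; apply: Pext P0 => x y.
  have S3 z : e z o0 + e z o1 + e z o2 = 0.
    rewrite -(h3 z) (bigD1 o0) //= (bigD1 o1) //= (bigD1 o2) //= big1 ?addr0 ?addrA // => w hw.
    by apply: hs; move: hw; rewrite !ordE /=; lia.
  have {}S3 := (S3 o0, S3 o1, S3 o2); rewrite !h2 (h1 o1 o0) (h1 o2 o0) (h1 o2 o1) in S3.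
  have [E01 E02 E12] : [/\ e o0 o1 = 0, e o0 o2 = 0 & e o1 o2 = 0] by case: S3 => [[]]; split; lia.
  have [y2|y2] := ltnP 2 y; first by rewrite hs // y2 orbT.
  have [x2|x2] := ltnP 2 x; first by rewrite hs // x2.
  have c3 (w : 'I_r) : (w <= 2)%N -> [\/ w = o0, w = o1 | w = o2].
    move=> w2; have [h|[h|h]] : (w = 0 :> nat \/ w = 1 :> nat \/ w = 2 :> nat)%N by lia.
    - by constructor 1; apply: ord_inj.
    - by constructor 2; apply: ord_inj.
    - by constructor 3; apply: ord_inj.
  by case: (c3 x x2) => ->; case: (c3 y y2) => ->; rewrite ?h2 // ?E01 ?E02 ?E12 // h1 ?E01 ?E02 ?E12.
have Cdown y : C y y -> C y.+1 0%N.
  move=> h e he hs; apply: h => // x z hxz; have [_ h2 _] := he.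
  case: (eqVneq x z) => [->|xz]; first exact: h2.
  by apply: hs; move: hxz xz; rewrite ordE /=; lia.
have Cstep (y j : nat) : (2 <= j)%N -> (j < y)%N -> (y < r)%N -> C y j -> C y j.+1.
  move=> j2 jy yr h e he hs.
  have jr : (j < r)%N by lia.
  pose oy := Ordinal yr; pose oj := Ordinal jr.
  (* The cycle through [y], [j], [0], [1] removes the edge [yj]; its other edges [j0], [y1] and [01]
     come earlier in the order. *)
  have u : uniq [:: oy; oj; o0; o1].
    by rewrite /= !inE !ordE /=; lia.
  apply: (Pq' e (e oy oj) oy oj o0 o1 u); apply: h; first exact: zero_degreeB.
  move=> x z hxz; have [h1 _ _] := he.
  have yj : oy != oj by rewrite ordE /=; lia.
  have V : e oy oj - e oy oj * quad oy oj o0 o1 oy oj = 0.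
    by rewrite /quad edge1 // !edge0 ?ordE /=; [ring | lia..].
  have [/andP [/eqP Ex /eqP Ez]|n1] := boolP ((x == y :> nat) && (z == j :> nat)).
    have -> : x = oy by apply: ord_inj.
    by have -> : z = oj by apply: ord_inj.
  have [/andP [/eqP Ez /eqP Ex]|n2] := boolP ((z == y :> nat) && (x == j :> nat)).
    have -> : z = oy by apply: ord_inj.
    have -> : x = oj by apply: ord_inj.
    by rewrite h1 quadC.
  rewrite hs; last by move: hxz n1 n2; lia.
  by rewrite /quad !edge0 ?ordE /= ?mulr0 //; move: hxz n1 n2; lia.
(* When only [y0] and [y1] remain at [y], their weights are opposite, and the cycle through [y],
   [0], [2], [1] removes both. *)
have Clast (y : nat) : (2 < y)%N -> (y < r)%N -> C y 0%N -> C y 2%N.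
  move=> y2 yr h e he hs.
  pose oy := Ordinal yr.
  have u : uniq [:: oy; o0; o2; o1].
    by rewrite /= !inE !ordE /=; lia.
  apply: (Pq' e (e oy o0) oy o0 o2 o1 u); apply: h; first exact: zero_degreeB.
  move=> x z hxz; have [h1 _ h3] := he.
  have S2 : e oy o0 + e oy o1 = 0.
    rewrite -(h3 oy) (bigD1 o0) //= (bigD1 o1) //= big1 ?addr0 // => w.
    by rewrite !ordE /= => hw; apply: hs => /=; move: hw; lia.
  have V w : e oy w - e oy o0 * quad oy o0 o2 o1 oy w = 0.
    case: (eqVneq w o0) => [->|w0].
      by rewrite /quad edge1 ?ordE /= 1?eq_sym ?edge0 ?ordE /=; [ring | lia..].
    case: (eqVneq w o1) => [->|w1].
      rewrite /quad [edge oy o1 _ _]edge1 ?ordE /=; last lia.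
      by rewrite !edge0 ?ordE /=; [move: S2; lia | lia..].
    rewrite hs; last by move: w0 w1; rewrite !ordE /=; lia.
    by rewrite /quad !edge0 ?mulr0 ?subr0 //; move: w0 w1; rewrite !ordE /=; lia.
  have [/eqP Ex|n1] := boolP (x == y :> nat).
    by have -> : x = oy by apply: ord_inj.
  have [/eqP Ez|n2] := boolP (z == y :> nat).
    have -> : z = oy by apply: ord_inj.
    by rewrite h1 quadC.
  rewrite hs; last by move: hxz n1 n2; lia.
  by rewrite /quad !edge0 ?ordE /= ?mulr0 //; move: hxz n1 n2; lia.
have Cy y : (2 <= y)%N -> (y < r)%N -> C y y.
  elim: y => // y IH; rewrite leq_eqVlt => /orP [/eqP <- _|y2 yr]; first exact: C2.
  have H j : (2 <= j)%N -> (j <= y.+1)%N -> C y.+1 j.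
    elim: j => // j IHj; rewrite leq_eqVlt => /orP [/eqP <- _|j2 jy].
      by apply: Clast => //; apply: Cdown; apply: IH; lia.
    by apply: Cstep => //; apply: IHj; lia.
  by apply: H; lia.
move=> e he; apply: (Cy r.-1) => //; [lia | lia |].
move=> x z h; have [_ h2 _] := he; case: (eqVneq x z) => [->|]; first exact: h2.
by rewrite ordE /=; have := ltn_ord x; have := ltn_ord z; lia.
Qed.

Local Close Scope ring_scope.

(** * The lattice of blocks *)

Local Open Scope ring_scope.

Definition unif lam (X : finType) (t : bool) (x y : X) : int :=
  (mult lam t * (x != y))%:Z.

(* Membership in the cone spanned by the blocks, up to multiples of the uniform
   vector; as the latter is the sum of all images of any one block under
   permutations, this is closed under subtraction of blocks. *)
Definition covered lam (X : finType) (N : nat) (v : bool -> X -> X -> int) : Prop :=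
  exists (T : nat) (s : seq {ffun star_index lam -> X}), forall t x y,
    (\sum_(b <- s) cov t b x y)%:Z = v t x y + (T * N)%:Z * unif lam t x y.

Definition latt lam (X : finType) N v :=
  @covered lam X N v /\ covered lam N (fun t x y => - v t x y).

Lemma covered_ext lam (X : finType) N (v w : bool -> X -> X -> int) :
  (forall t x y, v t x y = w t x y) -> covered lam N v -> covered lam N w.
Proof. by move=> h [T [s hs]]; exists T, s => t x y; rewrite hs h. Qed.

Lemma coveredD lam (X : finType) N (v w : bool -> X -> X -> int) :
  covered lam N v -> covered lam N w ->
  covered lam N (fun t x y => v t x y + w t x y).
Proof.
move=> [T1 [s1 h1]] [T2 [s2 h2]]; exists (T1 + T2)%N, (s1 ++ s2) => t x y.
by rewrite big_cat PoszD h1 h2 mulnDl PoszD; ring.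
Qed.

Lemma latt_ext lam (X : finType) N (v w : bool -> X -> X -> int) :
  (forall t x y, v t x y = w t x y) -> latt lam N v -> latt lam N w.
Proof.
by move=> h [h1 h2]; split; [apply: covered_ext h1|apply: covered_ext h2] => t x y; rewrite h.
Qed.

Lemma lattD lam (X : finType) N (v w : bool -> X -> X -> int) :
  latt lam N v -> latt lam N w -> latt lam N (fun t x y => v t x y + w t x y).
Proof.
move=> [h1 h2] [h3 h4]; split; first exact: coveredD.
by apply: covered_ext (coveredD h2 h4) => t x y; rewrite opprD.
Qed.

Lemma lattN lam (X : finType) N (v : bool -> X -> X -> int) :
  latt lam N v -> latt lam N (fun t x y => - v t x y).
Proof. by move=> [h1 h2]; split=> //; apply: covered_ext h1 => t x y; rewrite opprK. Qed.

Lemma latt0 lam (X : finType) N : latt lam N (fun _ (_ _ : X) => 0).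
Proof. by split; exists 0%N, [::] => t x y; rewrite big_nil mul0n mul0r ?oppr0 addr0. Qed.

Lemma lattM lam (X : finType) N (z : int) (v : bool -> X -> X -> int) :
  latt lam N v -> latt lam N (fun t x y => z * v t x y).
Proof.
move=> h; have hn (n : nat) : latt lam N (fun t x y => n%:Z * v t x y).
  elim: n => [|n IH]; first by apply: latt_ext (latt0 lam X N) => t x y; rewrite mul0r.
  by apply: latt_ext (lattD h IH) => t x y; rewrite intS mulrDl mul1r.
case: z => n; first exact: hn.
by apply: latt_ext (lattN (hn n.+1)) => t x y; rewrite NegzE mulNr.
Qed.

Lemma latt_sum lam (X T : finType) N (v : T -> bool -> X -> X -> int) :
  (forall j, latt lam N (v j)) -> latt lam N (fun t x y => \sum_j v j t x y).
Proof.
move=> h; have: forall l : seq T, latt lam N (fun t x y => \sum_(j <- l) v j t x y).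
  elim=> [|a l IH]; first by apply: latt_ext (latt0 lam X N) => t x y; rewrite big_nil.
  by apply: latt_ext (lattD (h a) IH) => t x y; rewrite big_cons.
exact.
Qed.

Lemma all_perms_uniform lam (X : finType) : exists2 N : nat,
  (1 < #|X|)%N -> (0 < N)%N &
  forall (b : {ffun star_index lam -> X}) t x y, injective b ->
  \sum_(s : {perm X}) cov t [ffun i => s (b i)] x y = (N * (mult lam t * (x != y)))%N.
Proof.
have [n hn] := perm_pair_count X; exists (n * (lam.*2.+1).*2)%N.
  move=> /card_gt1P [x [y [_ _ xy]]]; have [n0 _] := hn x y x y xy xy.
  by rewrite muln_gt0 n0.
move=> b t x y bi.
transitivity (\sum_(i : star_index lam) \sum_(j : star_index lam) incid t i j * (n * (x != y)))%N; last first.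
  transitivity ((\sum_(i : star_index lam) \sum_(j : star_index lam) (incid t i j : nat)) * (n * (x != y)))%N.
    by rewrite big_distrl; apply: eq_bigr => i _; rewrite big_distrl.
  by rewrite sum_incid; ring.
rewrite /cov exchange_big; apply: eq_bigr => i _.
rewrite exchange_big; apply: eq_bigr => j _; rewrite -big_distrr /=.
case hij: (incid t i j) => //; congr (_ * _)%N.
have bij : b i != b j by rewrite (inj_eq bi) (incid_neq hij).
under eq_bigr do rewrite !ffunE.
case: (eqVneq x y) => [<-|xy]; last by have [_ ->] := hn _ _ _ _ bij xy; rewrite muln1.
rewrite muln0 big1 // => s _; case: eqP => // Ex; case: eqP => // Ey.
by move: bij; rewrite -(inj_eq (@perm_inj _ s)) Ex Ey eqxx.
Qed.

Lemma latt_block lam (X : finType) (N : nat) (b : {ffun star_index lam -> X}) :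
  (forall t x y, \sum_(s : {perm X}) cov t [ffun i => s (b i)] x y
     = (N * (mult lam t * (x != y)))%N) ->
  latt lam N (fun t x y => (cov t b x y)%:Z).
Proof.
move=> hN; split.
  by exists 0%N, [:: b] => t x y; rewrite big_seq1 mul0n mul0r addr0.
(* The images under the other permutations sum to [N] times the uniform vector minus the block. *)
exists 1%N, [seq [ffun i => s (b i)] | s : {perm X} <- enum [pred s : {perm X} | s != 1%g]] => t x y.
rewrite big_map big_enum /= /unif mul1n -PoszM -hN [in RHS](bigD1 1%g) //=.
have -> : [ffun i => (1%g : {perm X}) (b i)] = b by apply/ffunP => i; rewrite ffunE perm1.
by rewrite PoszD addKr.
Qed.

(* Varying the values at the positions [i] and [j] independently, only the edge
   joining these two positions survives in the alternating sum. *)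
Lemma latt_quad lam r N (i j : star_index lam) (a b c d : 'I_r) :
  (forall (b : {ffun star_index lam -> 'I_r}) t x y, injective b ->
    \sum_(s : {perm 'I_r}) cov t [ffun i => s (b i)] x y
      = (N * (mult lam t * (x != y)))%N) ->
  (#|{: star_index lam}| + 4 <= r)%N -> uniq [:: a; b; c; d] -> i != j ->
  latt lam N (fun t x y => (incid t i j)%:Z * quad a b c d x y).
Proof.
move=> hN hr u ij.
(* The positions other than [i] and [j] take values in [R], which keeps the four blocks
   injective. *)
pose R := ~: [set a; b; c; d].
have cR : (#|{: star_index lam}| <= #|R|)%N.
  have : (#|[set a; b; c; d]| <= 4)%N.
    by rewrite !cardsU !cards1; lia.
  by have := cardsC [set a; b; c; d]; rewrite card_ord -/R; lia.
pose g (z : star_index lam) : 'I_r := enum_val (widen_ord cR (enum_rank z)).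
have g_inj : injective g.
  by move=> x y /enum_val_inj /(congr1 val) /= /ord_inj /enum_rank_inj.
have gR z : [/\ g z != a, g z != b, g z != c & g z != d].
  by have := enum_valP (widen_ord cR (enum_rank z)); rewrite !inE !negb_or -!andbA => /and4P.
pose B (p q : 'I_r) : {ffun star_index lam -> 'I_r} :=
  [ffun z => if z == i then p else if z == j then q else g z].
have B_inj p q : p \in [:: a; c] -> q \in [:: b; d] -> injective (B p q).
  rewrite /= !inE !negb_or -!andbA in u.
  have gp z : p \in [:: a; c] -> g z != p by rewrite !inE; have [? ? ? ?] := gR z; case/orP => /eqP ->.
  have gq z : q \in [:: b; d] -> g z != q by rewrite !inE; have [? ? ? ?] := gR z; case/orP => /eqP ->.
  move=> hp hq; have pq : p != q.
    move: hp hq u; rewrite !inE => /orP [] /eqP -> /orP [] /eqP -> /and4P [? ? ? /and4P [? ? ? _]] //.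
    by rewrite eq_sym.
  move=> x y; rewrite !ffunE.
  case: (eqVneq x i) => [->|xi]; case: (eqVneq y i) => [->|yi] //.
  - case: (eqVneq y j) => [_ /eqP|_ /eqP]; first by rewrite (negbTE pq).
    by rewrite eq_sym (negbTE (gp y hp)).
  - case: (eqVneq x j) => [_ /eqP|_ /eqP]; first by rewrite eq_sym (negbTE pq).
    by rewrite (negbTE (gp x hp)).
  case: (eqVneq x j) => [->|xj]; case: (eqVneq y j) => [->|yj] //.
  - by move=> /eqP; rewrite eq_sym (negbTE (gq y hq)).
  - by move=> /eqP; rewrite (negbTE (gq x hq)).
  - exact: g_inj.
have L p q : p \in [:: a; c] -> q \in [:: b; d] -> latt lam N (fun t x y => (cov t (B p q) x y)%:Z).
  by move=> hp hq; apply: latt_block => t x y; apply: hN; apply: B_inj.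
have La := L a b; have Lc := L c b; have Lad := L a d; have Lcd := L c d.
rewrite !inE !eqxx ?orbT in La Lc Lad Lcd.
have H := lattD (lattD (lattD (La isT isT) (lattN (Lc isT isT))) (lattN (Lad isT isT))) (Lcd isT isT).
apply: latt_ext H => t x y.
pose h p q z z' : int := (B p q z == x)%:R * (B p q z' == y)%:R.
have covE p q : (cov t (B p q) x y)%:Z = \sum_z \sum_z' (incid t z z')%:R * h p q z z'.
  rewrite /cov (big_morph Posz PoszD (erefl _)); apply: eq_bigr => z _.
  rewrite (big_morph Posz PoszD (erefl _)); apply: eq_bigr => z' _.
  by rewrite PoszM /h -natrM mulnb !natz.
rewrite !covE -!sumrB -big_split /=.
under eq_bigr => z _ do rewrite -!sumrB -big_split /=.
pose D z z' := (incid t z z')%:R * (h a b z z' - h c b z z' - h a d z z' + h c d z z').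
transitivity (\sum_z \sum_z' D z z').
  by apply: eq_bigr => z _; apply: eq_bigr => z' _; rewrite /D; ring.
have D0 z z' : ~~ ((z == i) && (z' == j)) -> ~~ ((z == j) && (z' == i)) -> D z z' = 0.
  rewrite /D /h !ffunE; case: (eqVneq z i) => [->|zi]; case: (eqVneq z' i) => [->|z'i] //=;
    rewrite ?incidii ?mul0r ?(negbTE ij) //=; do ?(case: eqP => //= _); move=> *; ring.
rewrite pair_big /= (bigD1 (i, j)) //= (bigD1 (j, i)) /=; last first.
  by rewrite xpair_eqE negb_and (eq_sym j) ij.
rewrite big1 ?addr0 => [|[z z']]; last first.
  by rewrite !xpair_eqE /= => /andP [h1 h2]; apply: D0.
have ji : (j == i) = false by rewrite eq_sym (negbTE ij).
rewrite /D /h !ffunE !eqxx ji (incidC t j i) /quad /edge -!mulnb !natrM.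
have -> : (incid t i j)%:Z = (incid t i j)%:R by rewrite natz.
ring.
Qed.

(* The rotations of one block have the degrees of a multiple of the uniform vector,
   so the difference is generated by alternating 4-cycles. *)
Lemma latt_uniform lam r N (n m : nat) : (0 < lam)%N ->
  (forall (b : {ffun star_index lam -> 'I_r}) t x y, injective b ->
    \sum_(s : {perm 'I_r}) cov t [ffun i => s (b i)] x y
      = (N * (mult lam t * (x != y)))%N) ->
  (#|{: star_index lam}| + 4 <= r)%N ->
  (m * (lam.*2.+1).*2 = n * r.-1)%N ->
  latt lam N (fun t (x y : 'I_r) => n%:Z * unif lam t x y).
Proof.
move=> l0 hN hr hm; case: r hN hr hm => [|r] hN hr hm; first by move: hr; lia.
have cK : (#|{: star_index lam}| <= r.+1)%N by lia.
pose g (z : star_index lam) : 'I_r.+1 := widen_ord cK (enum_rank z).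
have g_inj : injective g by move=> x y /(congr1 val) /= /ord_inj /enum_rank_inj.
pose B (c : 'I_r.+1) : {ffun star_index lam -> 'I_r.+1} := [ffun z => g z + c].
have LB c : latt lam N (fun t x y => (cov t (B c) x y)%:Z).
  by apply: latt_block => t x y; apply: hN => z z'; rewrite !ffunE => /addIr /g_inj.
(* Every point has degree [mult lam t * 2k] in all rotations together, so the relation between [m]
   and [n] makes the degrees of [e] vanish. *)
pose e t x y : int := n%:Z * unif lam t x y - m%:Z * \sum_c (cov t (B c) x y)%:Z.
have ze t : zero_degree (e t).
  split=> [x y|x|x].
  - by rewrite /e /unif eq_sym; congr (_ - _ * _); apply: eq_bigr => c _; rewrite covC.
  - rewrite /e /unif eqxx muln0 mulr0 sub0r big1 ?mulr0 ?oppr0 // => c _.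
    congr Posz; apply/eqP; rewrite -leqn0 leqNgt; apply/negP => /cov_gt0 [i [j [h E1 E2]]].
    have := etrans (esym E1) E2; rewrite !ffunE => /addIr /g_inj E.
    by rewrite E incidii in h.
  rewrite /e sumrB -!mulr_sumr exchange_big /=.
  have -> : \sum_y unif lam t x y = (mult lam t * r)%:Z.
    rewrite /unif -(big_morph Posz PoszD (erefl _)) -big_distrr /=; congr (Posz (_ * _)).
    have E : #|predC1 x| = r by rewrite cardC1 card_ord.
    rewrite -[RHS]E -sum1_card [RHS]big_mkcond.
    by apply: eq_bigr => y _; rewrite !inE eq_sym; case: (_ == _).
  have -> : \sum_c \sum_y (cov t (B c) x y)%:Z = (mult lam t * (lam.*2.+1).*2)%:Z.
    rewrite -sum_incid; under eq_bigr do rewrite -(big_morph Posz PoszD (erefl _)).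
    rewrite -(big_morph Posz PoszD (erefl _)); congr Posz.
    under eq_bigr => c _.
      rewrite /cov exchange_big; under eq_bigr do rewrite exchange_big; over.
    rewrite exchange_big; apply: eq_bigr => i _.
    rewrite exchange_big; apply: eq_bigr => j _.
    transitivity (incid t i j * \sum_(c : 'I_r.+1) (c == (x - g i)%R))%N; last first.
      by rewrite (@sum_unique _ _ (x - g i)) ?muln1.
    rewrite big_distrr; apply: eq_bigr => c _ /=; rewrite -big_distrr /=; congr (_ * _)%N.
    transitivity (\sum_y ((y == B c j) && (B c i == x)))%N.
      by apply: eq_bigr => y _; rewrite andbC eq_sym.
    rewrite (sum_delta _ (fun=> B c i == x)) ffunE; congr nat_of_bool.
    by rewrite [RHS]eq_sym subr_eq addrC eq_sym.
  by rewrite /= in hm; rewrite -!PoszM [(m * _)%N]mulnCA hm; apply/eqP; rewrite subr_eq0; apply/eqP; congr Posz; ring.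
have Pe (t0 : bool) (f : 'I_r.+1 -> 'I_r.+1 -> int) : zero_degree f ->
    latt lam N (fun t x y => (t == t0)%:R * f x y).
  move: f; apply: quad_generation.
  - by lia.
  - by move=> e1 e2 h; apply: latt_ext => t x y; rewrite h.
  - by apply: latt_ext (latt0 lam _ N) => t x y; rewrite mulr0.
  move=> f z a b c d u hf.
  (* An apex and a leaf isolate the star type, two leaves the clique type; a second leaf exists as
     [lam > 0]. *)
  have [i [j [ij hij]]] : exists i j : star_index lam, i != j /\ forall t, incid t i j = (t == t0).
    case: (t0); first by exists None, (Some ord0); split=> // -[].
    exists (Some ord0), (Some (inord 1)); have n01 : (ord0 : 'I_lam.*2.+1) != inord 1.
      by rewrite -val_eqE /= inordK //; lia.
    by split=> // -[]; rewrite /incid /= ?(inj_eq Some_inj) ?n01.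
  have := lattD hf (lattM z (latt_quad hN hr u ij)).
  by apply: latt_ext => t x y; rewrite hij natz; ring.
have := lattD (lattD (Pe true _ (ze true)) (Pe false _ (ze false))) (lattM m (latt_sum LB)).
by apply: latt_ext => -[] x y; rewrite /e /=; ring.
Qed.

(** The lattice yields one index congruent to [n] modulo [N]; each further full orbit of a block
    adds [N]. *)
Lemma index_design lam r : (0 < lam)%N -> (#|{: star_index lam}| + 4 <= r)%N ->
  exists2 N : nat, (0 < N)%N & forall n : nat, ((lam.*2.+1).*2 %| n * r.-1)%N ->
  exists T0, forall T, (T0 <= T)%N ->
    dec lam (fun x y : 'I_r => (n + T * N) * (x != y))%N.
Proof.
move=> l0 hr; have [N hN0 hN] := all_perms_uniform lam 'I_r.
exists N; first by apply: hN0; rewrite card_ord; lia.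
move=> n /dvdnP [m hm].
have [[T0 [s hs]] _] := latt_uniform l0 hN hr (esym hm).
exists T0 => T hT.
have cK : (#|{: star_index lam}| <= r)%N by lia.
pose g : {ffun star_index lam -> 'I_r} := [ffun z => widen_ord cK (enum_rank z)].
have g_inj : injective g by move=> x y; rewrite !ffunE => /(congr1 val) /= /ord_inj /enum_rank_inj.
have d1 : dec lam (fun x y : 'I_r => N * (x != y))%N.
  exists [seq [ffun i => p (g i)] | p : {perm 'I_r} <- enum {perm 'I_r}] => t x y.
  by rewrite big_map big_enum hN // mulnCA.
have d2 : dec lam (fun x y : 'I_r => (n + T0 * N) * (x != y))%N.
  exists s => t x y; have := hs t x y; rewrite /unif -!PoszM -PoszD => -[->]; ring.
apply: dec_ext (decD d2 (dec_muln (T - T0) d1)) => x y.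
by rewrite mulnA -mulnDl; congr (_ * _)%N; rewrite -addnA -mulnDl subnKC.
Qed.

Local Close Scope ring_scope.

(** * Orders and group sizes obtained from the lattice *)

Lemma nestable1 lam : nestable lam 1.
Proof. by apply: dec_ext (dec0 lam _) => x y; rewrite !ord1 eqxx. Qed.

Lemma nestable_prime_power lam p d : prime p -> 0 < d ->
  p ^ d = 1 %[mod (lam.*2.+1).*2] -> nestable lam (p ^ d).
Proof.
move=> pp d0 h; have [F _ cF] := pPrimePowerField pp d0.
by apply/(nestable_card _ cF)/nestable_field; rewrite cF.
Qed.

(** The index is taken 1 modulo [D'], so its prime factors do not divide [D'] and have powers that
    are 1 modulo [D']. Such powers are nestable by the field construction, and this allows the
    groups to be filled. *)
Lemma nestable_multiple lam r D : 0 < lam -> #|{: star_index lam}| + 4 <= r ->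
  r = 1 %[mod (lam.*2.+1).*2] -> 0 < D ->
  exists Q, [/\ 0 < Q, Q = 1 %[mod D] & nestable lam (r * Q)].
Proof.
set m := (lam.*2.+1).*2; set K := #|{: star_index lam}| => l0 hr hrm D0.
have [N N0 hN] := index_design l0 hr.
have [|T0 hT] := hN 1; first by rewrite mul1n -subn1 -eqn_mod_dvd ?hrm //; lia.
pose D' := D * m; have D'0 : 0 < D' by rewrite muln_gt0 D0.
pose N' := 1 + T0 * D' * N.
have copD p : p %| N' -> coprime p D'.
  move=> pN; rewrite coprime_sym /coprime -dvdn1; set g := gcdn D' p.
  have gD : g %| T0 * D' * N by rewrite mulnAC dvdn_mull // dvdn_gcdl.
  by rewrite -(dvdn_addl _ gD) (dvdn_trans (dvdn_gcdr _ _)).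
pose P q := [/\ 0 < q, q = 1 %[mod D'], nestable lam q & td (star_index lam) q].
have P1 : P 1 by split=> //; [apply: nestable1 | apply: td1].
have PM a b : P a -> P b -> P (a * b).
  move=> [a0 am na ta] [b0 bm nb tb]; split; first by rewrite muln_gt0 a0.
  - by rewrite -modnMm am bm modnMm muln1.
  - exact: nestableM.
  - exact: tdM.
have Pp p : prime p -> p %| N' -> forall d0, exists2 d, d0 <= d & P (p ^ d).
  move=> pp pN d0; have t0 : 0 < totient D' by rewrite totient_gt0.
  (* The totient gives residue 1; the other factor makes the power large enough for [d0] and for a
     transversal design. *)
  pose d := totient D' * (d0 + K).+1.
  have dd : (d0 + K).+1 <= d by apply: leq_pmull.
  exists d; first by lia.
  have E : p ^ d = 1 %[mod D'].
    by rewrite expnM -modnXm (Euler_exp_totient (copD p pN)) modnXm exp1n.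
  split=> //; first by rewrite expn_gt0 prime_gt0.
    apply: nestable_prime_power; rewrite ?(leq_trans _ dd) //.
    by have mD : m %| D' by [rewrite dvdn_mull]; rewrite -(modn_dvdm _ mD) E modn_dvdm.
  apply: td_prime_power; rewrite ?(leq_trans _ dd) //.
  apply: leq_trans (ltnW (ltn_expl d (prime_gt1 pp))); apply: leq_trans dd.
  by rewrite -/K leqW // leq_addl.
have hd : dec lam (fun x y : 'I_r => N' * (x != y)).
  by apply: hT; apply: leq_pmulr.
have [||q [q0 qm nq tq] hq] := dec_lift_iter P1 PM _ Pp _ hd; first by [].
  by move=> x; rewrite eqxx.
exists q; split=> //; last exact: nestable_gdd_fill.
have DD : D %| D' by apply: dvdn_mulr.
by rewrite -(modn_dvdm q DD) qm modn_dvdm.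
Qed.

Lemma uniform_threshold (A : nat -> nat -> Prop) n :
  (forall a, a < n -> exists T0, forall T, T0 <= T -> A a T) ->
  exists T0, forall a, a < n -> forall T, T0 <= T -> A a T.
Proof.
elim: n => [|n IH] h; first by exists 0.
have [a an|T1 h1] := IH; first by apply: h; lia.
have [T2 h2] := h n (leqnn _).
exists (maxn T1 T2) => a; rewrite ltnS leq_eqVlt => /orP [/eqP ->|an] T; rewrite geq_max => /andP [] *.
  exact: h2.
exact: h1.
Qed.

(** With a power of [m] as index, the divisibility in [index_design] holds whatever [r] is, and the
    group size obtained divides a power of [m]. Inflation then brings it to exactly [m ^ E], a size
    that different [r] can share. *)
Lemma gdd_power lam r : 0 < lam -> #|{: star_index lam}| + 4 <= r ->
  exists E0, forall E, E0 <= E -> gdd lam ((lam.*2.+1).*2 ^ E) r.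
Proof.
set m := (lam.*2.+1).*2; set K := #|{: star_index lam}| => l0 hr.
have m2 : 1 < m by rewrite /m; lia.
have [N N0 hN] := index_design l0 hr.
have [Tm hTm] := @uniform_threshold (fun a T => dec lam (fun x y : 'I_r => (m * a + T * N) * (x != y))) N
  (fun a _ => hN (m * a) (dvdn_mulr _ (dvdn_mulr _ (dvdnn m)))).
(* The index [m ^ j.+1] is split by dividing [m ^ j] by [N]; this [j] makes the quotient reach [Tm],
   a threshold good for all remainders. *)
pose j := N * Tm; pose q := m ^ j %/ N.
have hq : Tm <= q.
  by rewrite leq_divRL // mulnC; apply: ltnW; apply: ltn_expl.
have hd : dec lam (fun x y : 'I_r => m ^ j.+1 * (x != y)).
  have hqm : Tm <= m * q by apply: leq_trans hq _; apply: leq_pmull; lia.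
  apply: dec_ext (hTm (m ^ j %% N) (ltn_pmod _ N0) (m * q) hqm) => x y.
  by congr (_ * _); rewrite -mulnA -mulnDr addnC -divn_eq expnS.
pose P a := exists e, a %| m ^ e.
have P1 : P 1 by exists 0.
have PM a b : P a -> P b -> P (a * b).
  by move=> [e1 h1] [e2 h2]; exists (e1 + e2); rewrite expnD dvdn_mul.
have Pp p : prime p -> p %| m ^ j.+1 -> forall d0, exists2 d, d0 <= d & P (p ^ d).
  by move=> pp; rewrite Euclid_dvdX // => /andP [pm _] d; exists d => //; exists d; rewrite dvdn_exp2r.
have [||a [e /dvdnP [c hc]] ha] := dec_lift_iter P1 PM _ Pp _ hd.
- by rewrite expn_gt0; lia.
- by move=> x; rewrite eqxx.
(* Every prime divisor of the cofactor then has exponent at least [K] in it, enough for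
   [td_logn]. *)
exists (e + K) => E hE.
have EE : m ^ E = a * (c * m ^ (E - e)).
  by rewrite mulnA (mulnC a) -hc -expnD subnKC //; lia.
rewrite EE; apply: gdd_mulr ha; apply: td_logn.
  have : 0 < m ^ e * m ^ (E - e) by rewrite muln_gt0 !expn_gt0; lia.
  by rewrite hc mulnAC muln_gt0 => /andP [].
move=> p; rewrite mem_primes => /and3P [pp p0 pd].
have pm : p %| m.
  have : p %| m ^ E.
    by rewrite EE; apply: dvdn_mull.
  by rewrite Euclid_dvdX // => /andP [].
apply: leq_trans (ltnW (ltn_expl _ (prime_gt1 pp))).
apply: (@leq_trans (E - e)); first by rewrite -/K; lia.
by rewrite -pfactor_dvdn // dvdn_mull // dvdn_exp2r.
Qed.

(** * Truncated transversal designs *)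

(** Wilson's fundamental construction with constant weight [w]. *)
Lemma dec_weighted lam w (Z T : finType) (C : eqType) (c : Z -> C) (B : T -> {set Z}) :
  (forall x y, x != y -> \sum_th ((x \in B th) && (y \in B th)) = (c x != c y)) ->
  (forall th, gdd lam w #|B th|) ->
  dec lam (fun x y : Z * 'I_w => c x.1 != c y.1).
Proof.
move=> hB hg; have := dec_sum (A := predT) (fun th _ => gdd_on (hg th)).
apply: dec_ext => x y; case: (eqVneq x.1 y.1) => [->|xy].
  by rewrite eqxx big1 // => th _; rewrite !andbF.
by rewrite -hB //; apply: eq_bigr => th _; rewrite andbT.
Qed.

Definition trunc_point (l n : nat) (t : 'I_l -> nat) : finType :=
  {z : 'I_l * 'I_n | z.2 < t z.1}.

Definition trunc_group (l n : nat) (t : 'I_l -> nat) (z : trunc_point n t) : 'I_l :=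
  (val z).1.

Lemma card_trunc_group l n (t : 'I_l -> nat) i : t i <= n ->
  #|[set z : trunc_point n t | trunc_group z == i]| = t i.
Proof.
move=> tn; pose h (z : trunc_point n t) := (val z).2.
have <- : #|h @: [set z | trunc_group z == i]| = #|[set z : trunc_point n t | trunc_group z == i]|.
  apply: card_in_imset => -[[a b] p] [[c d] q]; rewrite !inE /trunc_group /h /= => /eqP ea /eqP ec e.
  by apply: val_inj; rewrite /= ea ec e.
have -> : h @: [set z | trunc_group z == i] = [set a : 'I_n | a < t i].
  apply/setP => a; rewrite inE; apply/imsetP/idP => [[[[b c] p]]|p].
    by rewrite inE /trunc_group /h /= => /eqP eb ->; rewrite -eb.
  by exists (exist _ (i, a) p); rewrite ?inE /trunc_group /h /=.
by rewrite -sum1_card -[RHS]card_ord -sum1_card (big_ord_widen n (fun=> 1)) //; apply: eq_bigl => a; rewrite inE.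
Qed.

Lemma card_trunc_point l n (t : 'I_l -> nat) : (forall i, t i <= n) ->
  #|{: trunc_point n t}| = \sum_i t i.
Proof.
move=> tn; rewrite -sum1_card (partition_big (@trunc_group l n t) predT) //=.
apply: eq_bigr => i _; rewrite -(card_trunc_group (tn i)) -sum1_card.
by apply: eq_bigl => z; rewrite inE.
Qed.

(** A block meets each untruncated group, so between [u] and [l] of its points survive. *)
Lemma gdd_truncated lam w l n (t : 'I_l -> nat) u : td 'I_l n ->
  u <= #|[set i | t i == n]| -> (forall r, u <= r -> r <= l -> gdd lam w r) ->
  dec lam (fun x y : trunc_point n t * 'I_w => trunc_group x.1 != trunc_group y.1).
Proof.
move=> [T [f hf]] hu hg.
pose B th := [set z : trunc_point n t | (val z).2 == f th (val z).1].
apply: (@dec_weighted lam w _ T _ _ B).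
  move=> [[i a] p] [[j b] q]; rewrite -val_eqE /= xpair_eqE /trunc_group /= => h.
  have [E|ij] := eqVneq i j.
    rewrite big1 // => th _; rewrite !inE /=; case: eqP => //= Ea; case: eqP => //= Eb.
    by move: h; rewrite Ea Eb E !eqxx.
  rewrite -[RHS](hf i j a b ij); apply: eq_bigr => th _; rewrite !inE /=.
  by rewrite (eq_sym a) (eq_sym b).
move=> th; pose h := @trunc_group l n t; apply: hg.
  apply: leq_trans hu _; apply: leq_trans (leq_imset_card h (B th)).
  apply: subset_leq_card; apply/subsetP => i; rewrite inE => /eqP ti.
  have p : (i, f th i).2 < t (i, f th i).1 by rewrite /= ti.
  by apply/imsetP; exists (exist _ (i, f th i) p) => //; rewrite inE.
have <- : #|h @: B th| = #|B th|.
  apply: card_in_imset => -[[a b] p] [[c d] q]; rewrite !inE /h /trunc_group /= => /eqP eb /eqP ed e.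
  by apply: val_inj; rewrite /= eb ed e.
by rewrite -[X in _ <= X]card_ord; apply: max_card.
Qed.

Lemma gdd_card lam w (Z : finType) r : #|Z| = r ->
  dec lam (fun x y : Z * 'I_w => x.1 != y.1) -> gdd lam w r.
Proof.
move=> <-; apply: (dec_bij (h := fun p => (enum_rank p.1, p.2))).
  exists (fun p => (enum_val p.1, p.2)) => -[a b] /=; first by rewrite enum_rankK.
  by rewrite enum_valK.
by move=> a b /=; rewrite (inj_eq enum_rank_inj).
Qed.

Lemma gdd_pbd_truncated lam w l n (t : 'I_l -> nat) u : td 'I_l n ->
  (forall i, t i <= n) -> u <= #|[set i | t i == n]| ->
  (forall r, u <= r -> r <= l -> gdd lam w r) ->
  (forall i, gdd lam w (t i)) -> gdd lam w (\sum_i t i).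
Proof.
move=> htd tn hu hg ht; apply: (gdd_card (card_trunc_point tn)).
have h1 := gdd_truncated htd hu hg.
pose A i := [set z : trunc_point n t | trunc_group z == i].
have h2 i : gdd lam w #|A i| by rewrite card_trunc_group.
have := decD h1 (dec_sum (A := predT) (fun i _ => gdd_on (h2 i))).
apply: dec_ext => -[x a] [y b] /=.
have [E|xy] := eqVneq (trunc_group x) (trunc_group y).
  rewrite add0n (bigD1 (trunc_group x)) //= !inE E eqxx /= big1 ?addn0 // => i hi.
  by rewrite !inE E eq_sym (negbTE hi).
rewrite big1 ?addn0; first by case: (eqVneq x y) => // e; rewrite e eqxx in xy.
by move=> i _; rewrite !inE; case: eqP => //= <-; rewrite eq_sym (negbTE xy).
Qed.

Lemma sum_ord_ltn n A : A <= n -> \sum_(i < n) (i < A) = A.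
Proof.
move=> An; rewrite -[RHS]card_ord -sum1_card (big_ord_widen n (fun=> 1)) //.
by rewrite [RHS]big_mkcond; apply: eq_bigr => i _; case: ltnP.
Qed.

(** Strong induction: [r] is the order of a truncated transversal design whose block sizes are
    smaller and at least [u], as are its groups of more than one point. *)
Lemma gdd_all lam w u : 1 < u ->
  (forall r, u <= r -> r <= 6 * u ^ 2 -> gdd lam w r) ->
  forall r, u <= r -> gdd lam w r.
Proof.
move=> u1 hu r; have [N] := ubnP r; elim: N r => // N IH r /ltnSE rN ur.
have [rs|rb] := leqP r (6 * u ^ 2); first exact: hu.
have ru : 0 < r %/ u by rewrite divn_gt0 //; lia.
have /andP [] := @trunc_log_bounds 2 (r %/ u) isT ru.
set j := trunc_log 2 _; rewrite leq_divRL ?ltn_divLR ?(ltnW u1) // expnS.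
set n := 2 ^ j => h1 h2.
have n3 : 3 * u < n.
  rewrite ltnNge; apply/negP => h; move: rb; rewrite ltnNge => /negP; apply.
  rewrite -mulnn; nia.
have nr : n < r by nia.
have j0 : 0 < j by rewrite lt0n; apply/eqP => E; move: n3; rewrite /n E; lia.
have IHn r' : u <= r' -> r' <= n -> gdd lam w r' by move=> *; apply: IH; lia.
pose q := (r - n * u) %/ n; pose s := (r - n * u) %% n.
have hqs : r - n * u = q * n + s by apply: divn_eq.
have sn : s < n by rewrite ltn_mod; lia.
have qu : q < u by rewrite /q ltn_divLR; nia.
pose A := u + q.
(* After [A] full groups the remainder [s] becomes one group if [u <= s], and [s] single points
   otherwise. There is room because [A < 2u] and [3u < n]. *)
pose t (i : 'I_n) := n * (i < A) + (if u <= s then s * (i == A :> nat) else (A <= i) && (i < A + s)).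
have htd : td 'I_n n by apply: td_prime_power; rewrite ?card_ord.
have tE i : t i = if i < A then n else if u <= s then s * (i == A :> nat) else (i < A + s).
  rewrite /t; case: (ltnP i A) => iA; rewrite ?muln0 ?muln1 ?add0n //=.
  by rewrite ltn_eqF // muln0 if_same addn0.
have -> : r = \sum_i t i.
  rewrite big_split /= -big_distrr /= sum_ord_ltn; last by lia.
  have -> : \sum_(i < n) (if u <= s then s * (i == A :> nat) else (A <= i) && (i < A + s)) = s.
    case: leqP => us.
      have An : A < n by lia.
      rewrite -big_distrr /= (_ : \sum_(i < n) (i == A :> nat) = 1) ?muln1 //.
      exact: (@sum_unique _ _ (Ordinal An)).
    have : \sum_(i < n) (A <= i) && (i < A + s) + \sum_(i < n) (i < A) = \sum_(i < n) (i < A + s).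
      by rewrite -big_split; apply: eq_bigr => i _ /=; lia.
    by rewrite !sum_ord_ltn; lia.
  by rewrite /A; nia.
apply: (gdd_pbd_truncated htd (u := u)) => //.
- move=> i; rewrite tE; case: ifP => // _; case: ifP => _.
    by case: eqP => _; rewrite ?muln1 ?muln0 // ltnW.
  by apply: leq_trans (leq_b1 _) _; lia.
- have uA : u <= n by lia.
  rewrite -{1}(sum_ord_ltn uA) -sum1_card [X in _ <= X]big_mkcond; apply: leq_sum => i _ /=.
  rewrite inE tE; case: (ltnP i u) => // iu.
  by rewrite (_ : i < A = true) ?eqxx // /A; lia.
- move=> i; rewrite tE; case: ifP => _; first by apply: IHn; lia.
  case: ifP => us; last by apply: gdd_le1; case: (_ < _).
  case: eqP => _; last by apply: gdd_le1; rewrite muln0.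
  by rewrite muln1; apply: IHn; lia.
Qed.

(** * Filling groups around a common hole *)

Lemma dec_fill_holes lam (Y C : finType) (grp : Y -> option C) (A : pred C) :
  (forall i, A i -> holed lam #|[set x | grp x == Some i]| #|[set x | grp x == None]|) ->
  dec lam (fun x y => \sum_(i | A i) [&& x != y,
    grp x \in [:: Some i; None], grp y \in [:: Some i; None] &
    (grp x == Some i) || (grp y == Some i)]).
Proof.
move=> h; apply: dec_sum => i Ai.
have dis : [disjoint [set x | grp x == Some i] & [set x | grp x == None]].
  by apply/pred0P => x; rewrite /= !inE; case: eqP => // ->.
apply: dec_ext (holed_on (erefl _) (erefl _) dis (h i Ai)) => x y.
rewrite !inE; congr nat_of_bool.
by case: (x != y); rewrite ?andbF.
Qed.

Lemma sum_pred1 (C : finType) (A : pred C) (i : C) : \sum_(l | A l) (l == i) = A i.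
Proof.
case Ai: (A i); last by rewrite big1 // => l Al; case: eqP => // E; rewrite -E Al in Ai.
by rewrite (bigD1 i) //= eqxx big1 // => l /andP [_ /negbTE ->].
Qed.

Lemma sum_holes (Y C : finType) (grp : Y -> option C) (A : pred C) x y : x != y ->
  \sum_(i | A i) [&& x != y,
    grp x \in [:: Some i; None], grp y \in [:: Some i; None] &
    (grp x == Some i) || (grp y == Some i)] =
  match grp x, grp y with
  | Some i, Some j => (i == j) && A i
  | Some i, None | None, Some i => A i
  | None, None => false
  end.
Proof.
move=> xy; under eq_bigr do rewrite xy !inE.
case: (grp x) => [i|]; case: (grp y) => [j|] /=.
- have [<-|ij] := eqVneq i j.
    rewrite /= -(sum_pred1 A i); apply: eq_bigr => l _; rewrite (inj_eq Some_inj) !orbF eq_sym.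
    by case: (_ == _).
  rewrite big1 // => l _; rewrite !(inj_eq Some_inj) !orbF; case: eqP => //= <-.
  by rewrite eq_sym (negbTE ij).
- rewrite -(sum_pred1 A i); apply: eq_bigr => l _; rewrite (inj_eq Some_inj) !orbF eq_sym.
  by case: (_ == _).
- rewrite -(sum_pred1 A j); apply: eq_bigr => l _; rewrite (inj_eq Some_inj) !orbF eq_sym.
  by case: (_ == _).
- by rewrite big1.
Qed.

(** The value [None] of [grp] marks the hole. Its inner pairs must be covered only once, so only
    [i0] is filled together with it. *)
Lemma nestable_fill lam (Y C : finType) (grp : Y -> option C) (i0 : C) v :
  #|Y| = v ->
  dec lam (fun x y => [&& grp x != None, grp y != None & grp x != grp y]) ->
  (forall i, i != i0 ->
    holed lam #|[set x | grp x == Some i]| #|[set x | grp x == None]|) ->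
  nestable lam #|[set x | grp x \in [:: Some i0; None]]| -> nestable lam v.
Proof.
move=> cY h1 h2 h3; apply/(nestable_card _ cY).
have := decD h1 (decD (nestable_on h3) (dec_fill_holes h2)); apply: dec_ext => x y.
case: (eqVneq x y) => [->|xy]; first by rewrite eqxx !andbF big1.
rewrite -[~~ false]xy sum_holes // !inE xy.
case: (grp x) => [i|]; case: (grp y) => [j|] //=; rewrite ?(inj_eq Some_inj) ?orbF /=.
- have [<-|ij] := eqVneq i j; first by case: (i == i0).
  by rewrite addn0; case: eqP => //= <-; rewrite eq_sym (negbTE ij).
- by case: (_ == _).
- by case: (_ == _).
Qed.

Lemma holed_card lam (Y : finType) (B : {set Y}) g f : #|~: B| = g -> #|B| = f ->
  dec lam (fun x y => (x != y) && ((x \notin B) || (y \notin B))) -> holed lam g f.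
Proof.
move=> <- <-.
pose h (p : 'I_#|~: B| + 'I_#|B|) : Y := match p with inl a => enum_val a | inr b => enum_val b end.
have hB p : (h p \in B) = ~~ is_inl p.
  case: p => a /=; last exact: enum_valP.
  by apply/negbTE; have := enum_valP a; rewrite inE.
have h_inj : injective h.
  move=> p q E; have := hB p; rewrite E hB.
  by case: p q E => [a|a] [b|b] //= /enum_val_inj ->.
have h_bij : bijective h.
  apply: inj_card_bij => //; rewrite card_sum !card_ord addnC.
  by rewrite cardsC.
have [k hK kK] := h_bij.
apply: (dec_bij (h := k)); first by exists h.
by move=> a b; rewrite -(kK a) -(kK b) !hK !hB !negbK (inj_eq h_inj).
Qed.

Lemma holed_fill lam (Y C : finType) (grp : Y -> option C) g f :
  #|[set x | grp x != None]| = g -> #|[set x | grp x == None]| = f ->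
  dec lam (fun x y => [&& grp x != None, grp y != None & grp x != grp y]) ->
  (forall i, holed lam #|[set x | grp x == Some i]| f) -> holed lam g f.
Proof.
move=> hg hf h1 h2; subst f.
apply: (holed_card (B := [set x | grp x == None])) => //.
  by rewrite -hg; apply: eq_card => x; rewrite !inE.
have := decD h1 (dec_fill_holes (A := predT) (fun i _ => h2 i)).
apply: dec_ext => x y; case: (eqVneq x y) => [->|xy]; first by rewrite eqxx !andbF big1.
rewrite -[~~ false]xy sum_holes // !inE xy.
case: (grp x) => [i|]; case: (grp y) => [j|] //=; rewrite ?(inj_eq Some_inj) /=.
by case: (_ == _).
Qed.

(** * Filling holes *)

Definition ext_group (Z C : Type) w f (c : Z -> C) (x : Z * 'I_w + 'I_f) : option C :=
  if x is inl z then Some (c z.1) else None.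

Lemma card_ext_some (Z C : finType) w f (c : Z -> C) i :
  #|[set x : Z * 'I_w + 'I_f | ext_group c x == Some i]| = #|[set z | c z == i]| * w.
Proof.
have -> : [set x : Z * 'I_w + 'I_f | ext_group c x == Some i]
    = inl @: setX [set z | c z == i] [set: 'I_w].
  apply/setP => -[[z a]|b]; rewrite inE /=.
    rewrite mem_imset; last by move=> ? ? [].
    rewrite in_setX !inE andbT /=.
    exact: (inj_eq Some_inj).
  by apply/esym/imsetP => -[].
by rewrite card_imset ?cardsX ?cardsT ?card_ord // => x y [].
Qed.

Lemma card_ext_none (Z C : finType) w f (c : Z -> C) :
  #|[set x : Z * 'I_w + 'I_f | ext_group c x == None]| = f.
Proof.
have -> : [set x : Z * 'I_w + 'I_f | ext_group c x == None] = inr @: [set: 'I_f].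
  apply/setP => -[[z a]|b]; rewrite inE /=.
    by apply/esym/imsetP => -[].
  by apply/esym; rewrite imset_f.
by rewrite card_imset ?cardsT ?card_ord // => x y [].
Qed.

Lemma dec_ext_group lam (Z C : finType) w f (c : Z -> C) :
  dec lam (fun x y : Z * 'I_w => c x.1 != c y.1) ->
  dec lam (fun x y : Z * 'I_w + 'I_f =>
    [&& ext_group c x != None, ext_group c y != None & ext_group c x != ext_group c y]).
Proof.
apply: (dec_map (h := inl)); first by move=> x y [].
  by move=> x y /=; rewrite (inj_eq Some_inj).
by move=> [x|x] [y|y] //= _; rewrite !codom_f.
Qed.

(** Inflate [n + 1] points by [f] and fill all groups but one, which becomes the hole. *)
Lemma holed_product lam n f : td (star_index lam) f ->
  nestable lam n.+1 -> nestable lam f -> holed lam (n * f) f.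
Proof.
move=> hf hn Sf; pose B : {set 'I_n.+1 * 'I_f} := setX [set ord0] setT.
have cB : #|B| = f by rewrite cardsX cards1 cardsT card_ord mul1n.
apply: (holed_card _ cB).
  by have := cardsC B; rewrite cB card_prod !card_ord mulSn; lia.
have h (i : 'I_n.+1) : nestable lam #|setX [set i] [set: 'I_f]|.
  by rewrite cardsX cards1 cardsT card_ord mul1n.
have := decD (dec_inflate hf hn)
  (dec_sum (A := [pred i : 'I_n.+1 | i != ord0]) (fun i _ => nestable_on (h i))).
apply: dec_ext => -[x a] [y b] /=.
have [<-|xy] := eqVneq x y; last first.
  rewrite big1 => [|i _]; last first.
    by rewrite !in_setX !inE !andbT; case: eqP => //= <-; rewrite eq_sym (negbTE xy).
  rewrite !in_setX !inE !andbT xpair_eqE (negbTE xy) /=.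
  by have [E|//] := eqVneq x ord0; rewrite E eq_sym in xy; rewrite xy.
rewrite !in_setX !inE !andbT orbb add0n xpair_eqE eqxx /=.
have -> : (a != b) && (x != ord0) = ((x != ord0) * (a != b)) :> nat by rewrite mulnb andbC.
rewrite -(sum_pred1 [pred i | i != ord0] x) big_distrl /=; apply: eq_bigr => i _.
by rewrite !in_setX !inE !andbT mulnb (eq_sym x); case: (i == x).
Qed.

Lemma holed_gdd lam w r f : gdd lam w r -> holed lam w f -> holed lam (r * w) f.
Proof.
move=> hg hh; pose grp := @ext_group 'I_r 'I_r w f id.
have cN : #|[set x | grp x == None]| = f by apply: card_ext_none.
apply: (holed_fill _ cN); last 1 first.
- move=> i; rewrite card_ext_some (_ : [set z | z == i] = [set i]) ?cards1 ?mul1n //.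
  by apply/setP => z; rewrite !inE.
- have := cardsC [set x | grp x == None]; rewrite cN card_sum card_prod !card_ord addnC => /addIn <-.
  by apply: eq_card => x; rewrite !inE.
- exact: dec_ext_group.
Qed.

(** The [u] full groups are filled around the [f] extra points, the truncated one together with
    them; blocks have [u] or [u + 1] points. *)
Lemma nestable_truncated lam w u n t f : td 'I_u.+1 n -> t <= n ->
  gdd lam w u -> gdd lam w u.+1 -> holed lam (n * w) f ->
  nestable lam (t * w + f) -> nestable lam ((u * n + t) * w + f).
Proof.
move=> htd tn gu gu1 hh hS.
pose s (i : 'I_u.+1) := if i < u then n else t.
have sn i : s i <= n by rewrite /s; case: ifP.
pose grp := @ext_group (trunc_point n s) 'I_u.+1 w f (@trunc_group _ _ _).
have cN : #|[set x | grp x == None]| = f by apply: card_ext_none.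
have cS i : #|[set x | grp x == Some i]| = s i * w by rewrite card_ext_some card_trunc_group.
apply: (@nestable_fill lam _ _ grp ord_max).
- rewrite card_sum card_prod !card_ord card_trunc_point // big_ord_recr /= /s ltnn.
  by under eq_bigr do rewrite /= ltn_ord; rewrite sum_nat_const card_ord.
- apply/dec_ext_group/(gdd_truncated htd (u := u)).
    rewrite -{1}(sum_ord_ltn (leqnSn u)) -sum1_card [X in _ <= X]big_mkcond.
    by apply: leq_sum => i _; rewrite inE /s; case: ltnP => // _; rewrite eqxx.
  by move=> r ur; rewrite leq_eqVlt => /orP [/eqP -> //|ru]; have -> : r = u by lia.
- move=> i hi; rewrite cN cS /s.
  have -> : i < u by move: hi; rewrite -val_eqE /=; have := ltn_ord i; lia.
  by [].
rewrite (_ : [set x | _] = [set x | grp x == Some ord_max] :|: [set x | grp x == None]); last first.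
  by apply/setP => x; rewrite !inE.
rewrite cardsU cN cS /s /= ltnn (_ : _ :&: _ = set0) ?cards0 ?subn0 //.
by apply/setP => x; rewrite !inE; case: eqP => //= ->.
Qed.

(** * Assembly of all large orders *)

Lemma eventually_mod (A : nat -> Prop) n : 0 < n ->
  (forall c, c < n -> exists v0, forall v, v0 <= v -> v %% n = c -> A v) ->
  exists v0, forall v, v0 <= v -> A v.
Proof.
move=> n0 h; have [v0 hv] := @uniform_threshold (fun c v => v %% n = c -> A v) n h.
by exists v0 => v vv; apply: (hv (v %% n)) => //; rewrite ltn_mod.
Qed.

Lemma small_primes_coprime u m : exists2 d, 0 < d /\ coprime m d &
  forall p, prime p -> p <= u -> ~~ (p %| m) -> p %| d.
Proof.
pose d := \prod_(p < u.+1 | prime p && ~~ (p %| m)) (p : nat).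
exists d.
  split; first by apply: prodn_cond_gt0 => p /andP [/prime_gt0].
  apply: (big_ind (coprime m)); first exact: coprimen1.
    by move=> a b ha hb; rewrite coprimeMr ha.
  by move=> p /andP [pp pm]; rewrite coprime_sym prime_coprime.
move=> p pp pu pm; have pu' : p < u.+1 by [].
by rewrite /d (bigD1 (Ordinal pu')) /= ?pp ?pm // dvdn_mulr.
Qed.

Lemma eqmod_dvd m n a b : m %| n -> a = b %[mod n] -> a = b %[mod m].
Proof. by move=> mn e; rewrite -(modn_dvdm a mn) e modn_dvdm. Qed.

Lemma eqmod1_dvdF p n a : prime p -> p %| n -> a = 1 %[mod n] -> ~~ (p %| a).
Proof.
move=> pp pn /(eqmod_dvd pn) e; rewrite /dvdn e -/(dvdn p 1) dvdn1.
by rewrite gtn_eqF // prime_gt1.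
Qed.

Lemma eqmod_mul1 n a b q : a = b %[mod n] -> q = 1 %[mod n] -> a * q = b %[mod n].
Proof. by move=> ea eq; rewrite -modnMm ea eq modnMm muln1. Qed.

Lemma nestable_eventually lam : 0 < lam -> exists v0, forall v, v0 <= v ->
  v = 1 %[mod (lam.*2.+1).*2] -> nestable lam v.
Proof.
set m := (lam.*2.+1).*2 => l0; set K := #|{: star_index lam}|.
have m0 : 0 < m by [].
have m2 : 2 %| m by rewrite /m -mul2n dvdn_mulr.
pose u := K + 4.
have u1 : 1 < u by rewrite /u !addnS.
have [E0 hE0] : exists E0, forall r, r < (6 * u ^ 2).+1 -> forall E, E0 <= E ->
    u <= r -> gdd lam (m ^ E) r.
  apply: uniform_threshold => r _; have [ur|ru] := leqP u r; last by exists 0 => E _; lia.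
  by have [E0 h] := gdd_power l0 ur; exists E0 => E hE _; apply: h.
(* The successor ensures that [m] divides [w]. *)
pose E := E0.+1; pose w := m ^ E.
have w0 : 0 < w by rewrite expn_gt0.
have mw : m %| w by apply: dvdn_exp.
have gddw r : u <= r -> gdd lam w r.
  by apply: gdd_all => // r' h1 h2; apply: hE0.
have [d [d0 cmd] hd] := small_primes_coprime u.+1 m.
have cwd : coprime w d by rewrite coprimeXl.
have noprime p : prime p -> p <= u.+1 -> p %| m \/ p %| d.
  by move=> pp pu; have [?|/hd ?] := boolP (p %| m); [left|right; auto].
apply: (@eventually_mod (fun v => v = 1 %[mod m] -> nestable lam v) w) => // c cw.
have [c1|c1] := eqVneq (c %% m) (1 %% m); last first.
  by exists 0 => v _ vc vm; move: c1; rewrite -vc modn_dvdm // vm eqxx.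
(* The Chinese remainder theorem prescribes the residues, and the multiplier from
   [nestable_multiple], being 1 modulo [D], preserves them. *)
have rep a b n D : coprime a b -> 0 < a -> 0 < b -> (m %| a) -> a %| D -> b %| D -> 0 < D ->
    n = 1 %[mod m] -> forall e, exists f, [/\ nestable lam f, f = n %[mod a] & f = e %[mod b]].
  move=> cab a0 b0 ma aD bD D0 nm e.
  pose r := chinese a b n e + a * b * u.
  have ra : r = n %[mod a] by rewrite /r -mulnA addnC mulnC modnMDl chinese_modl.
  have rb : r = e %[mod b] by rewrite /r mulnAC addnC modnMDl chinese_modr.
  have ur : u <= r by apply: leq_trans (leq_addl _ _); apply: leq_pmull; rewrite muln_gt0 a0.
  have rm : r = 1 %[mod m] by rewrite -nm; apply: eqmod_dvd ra.
  have [q [q0 qD hq]] := nestable_multiple l0 ur rm D0.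
  exists (r * q); split=> //; apply: eqmod_mul1 => //.
    exact: eqmod_dvd qD.
  exact: eqmod_dvd qD.
have wd0 : 0 < w * d by rewrite muln_gt0 w0.
(* Residue 1 modulo [m] and modulo [d] keeps [f] free of primes up to [u + 1]. *)
have [f [Sf fw fd]] := rep w d c (w * d) cwd w0 d0 mw (dvdn_mulr _ (dvdnn w)) (dvdn_mull _ (dvdnn d)) wd0 c1 1.
have fm : f = 1 %[mod m] by rewrite -c1; apply: eqmod_dvd fw.
have wm0 : 0 < w * m by rewrite muln_gt0 w0.
have wmd0 : 0 < w * m * d by rewrite muln_gt0 wm0.
have cwmd : coprime (w * m) d by rewrite coprimeMl cwd.
have w1m : 1 + w = 1 %[mod m] by have /eqP e := mw; rewrite -modnDmr e.
(* The aim is [n - 1 = w * g1] with [g1] free of primes up to [u + 1]: the first residue gives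
   [g1 = 1] modulo [m], the second gives [n - 1 = -2] modulo [d], whose primes are odd. *)
have [n [Sn nw nd]] := rep (w * m) d (1 + w) (w * m * d) cwmd wm0 d0 (dvdn_mull _ (dvdnn m))
  (dvdn_mulr _ (dvdnn _)) (dvdn_mull _ (dvdnn d)) wmd0 w1m d.-1.
have n0 : 0 < n.
  rewrite lt0n; apply/eqP => en; have := eqmod_dvd (dvdn_mull w (dvdnn m)) nw.
  by rewrite en mod0n w1m modn_small.
have f0 : 0 < f.
  by rewrite lt0n; apply/eqP => ef; move: fm; rewrite ef mod0n modn_small.
have [g1 hg1] : exists g1, n.-1 = w * g1.
  exists (n.-1 %/ w); rewrite mulnC divnK // -subn1 -eqn_mod_dvd //.
  rewrite (eqmod_dvd (dvdn_mulr m (dvdnn w)) nw); apply/eqP.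
  by rewrite addnC -{1}(mul1n w) modnMDl.
have g1m : g1 = 1 %[mod m].
  have : w * g1 = w * 1 %[mod w * m].
    by apply/eqP; rewrite -(eqn_modDl 1) -hg1 add1n prednK // muln1; apply/eqP.
  by rewrite -!muln_modr => /eqP; rewrite eqn_pmul2l // => /eqP.
pose g := g1 * f.
have fbig p : prime p -> p %| f -> u.+1 < p.
  move=> pp pf; rewrite ltnNge; apply/negP => /(noprime p pp) [pm|pd].
    by have := eqmod1_dvdF pp pm fm; rewrite pf.
  by have := eqmod1_dvdF pp pd fd; rewrite pf.
have gbig p : prime p -> p %| g -> u.+1 < p.
  move=> pp; rewrite Euclid_dvdM // => /orP [pg|]; last exact: fbig.
  rewrite ltnNge; apply/negP => /(noprime p pp) [pm|pd].
    by have := eqmod1_dvdF pp pm g1m; rewrite pg.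
  have pn1 : p %| n.-1 by rewrite hg1 dvdn_mull.
  have pn2 : p %| n.+1.
    have e := eqmod_dvd pd nd.
    by rewrite -addn1 /dvdn -modnDml e modnDml addn1 prednK // -/(dvdn p d).
  have : p %| n.+1 - n.-1 by apply: dvdn_sub.
  have -> : n.+1 - n.-1 = 2 by case: (n) n0 => // a _; rewrite -addn2 addKn.
  rewrite dvdn_prime2 // => /eqP ep; subst p.
  by have : 2 %| gcdn m d by [rewrite dvdn_gcd m2]; rewrite (eqP cmd).
have g10 : 0 < g1 by rewrite lt0n; apply/eqP => e; move: g1m; rewrite e mod0n modn_small.
have g0 : 0 < g by rewrite muln_gt0 g10.
have tdf : td (star_index lam) f.
  by apply: td_big_primes => // p pp pf; have := fbig p pp pf; rewrite /u -/K; clear; lia.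
have tdg : td (star_index lam) g.
  by apply: td_big_primes => // p pp pf; have := gbig p pp pf; rewrite /u -/K; clear; lia.
have hole1 : holed lam (w * g) f.
  by rewrite /g mulnA -hg1; apply: holed_product; rewrite ?prednK.
have hole y : u <= y -> holed lam (y * (w * g)) f.
  by move=> uy; apply: holed_gdd hole1; apply: gdd_mulr => //; apply: gddw.
(* The factorial will make [y = z (u + 1)! + 1] free of primes up to [u + 1]. *)
pose M := w * g * u * (u.+1)`!.
have M0 : 0 < M by rewrite !muln_gt0 w0 g10 f0 fact_gt0 (ltnW u1).
have wM : w %| M by rewrite /M -!mulnA dvdn_mulr.
have [|v0 hv0] := @eventually_mod (fun v => v %% w = c -> v = 1 %[mod m] -> nestable lam v) M M0; last first.
  by exists v0 => v vv; apply: hv0.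
move=> rho rhoM.
have [rc|rc] := eqVneq (rho %% w) c; last first.
  by exists 0 => v _ vr vc; move: rc; rewrite -vr modn_dvdm // vc eqxx.
(* This represents [rho - w * g * u] modulo [M] by a number at least [u + f]. *)
pose r3 := rho + M * (u + f) + (M - w * g * u).
have lM : w * g * u <= M by rewrite /M leq_pmulr // fact_gt0.
have r3E : r3 + w * g * u = rho %[mod M].
  by rewrite /r3 -addnA subnK // -addnA -mulnSr addnC mulnC modnMDl.
have w3 : r3 = c %[mod w].
  have e : r3 + w * g * u = r3 %[mod w] by rewrite -mulnA addnC (mulnC w) modnMDl.
  by rewrite -e (eqmod_dvd wM r3E) rc modn_small.
have u3 : u + f <= r3.
  by rewrite /r3 -addnA; apply: leq_trans (leq_addl _ _); apply: leq_trans (leq_addr _ _); apply: leq_pmull.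
have m3 : r3 = 1 %[mod m] by rewrite -c1; apply: eqmod_dvd w3.
have [q3 [q30 q3M S3]] := nestable_multiple l0 (leq_trans (leq_addr f u) u3) m3 M0.
pose f3 := r3 * q3.
have f3M : f3 = r3 %[mod M] by apply: eqmod_mul1.
have ff3 : f <= f3.
  by apply: leq_trans (leq_trans (leq_addl u f) u3) _; apply: leq_pmulr.
have [t ht] : exists t, f3 = t * w + f.
  exists ((f3 - f) %/ w); rewrite divnK ?subnK // -eqn_mod_dvd //; apply/eqP.
  by rewrite fw (eqmod_dvd wM f3M) w3.
(* The threshold gives [u + t < y], so the truncated group fits and the holed fillings exist. *)
exists (f3 + w * g * u * (u + t).+1) => v hv vr vc vm.
have le1 : f3 + w * g * u <= v.
  by apply: leq_trans hv; rewrite leq_add2l leq_pmulr.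
have [z hz] : exists z, v = f3 + w * g * u + z * M.
  exists ((v - (f3 + w * g * u)) %/ M); rewrite divnK ?subnKC // -eqn_mod_dvd //; apply/eqP.
  by rewrite -modnDml f3M modnDml r3E -vr modn_mod.
pose y := z * (u.+1)`! + 1.
have hzy : v = f3 + w * g * u * y by rewrite hz /M /y; ring.
have wgu0 : 0 < w * g * u by rewrite !muln_gt0 w0 g10 f0 (ltnW u1).
have uty : u + t < y by move: hv; rewrite hzy leq_add2l leq_pmul2l.
have td1' : td 'I_u.+1 (g * y).
  apply: td_big_primes => [|p pp]; first by rewrite muln_gt0 g0 /y addn1.
  rewrite card_ord Euclid_dvdM // => /orP [/(gbig p pp) /ltnW //|py].
  rewrite leqNgt; apply/negP => pu.
  have : p %| (u.+1)`! by apply: dvdn_fact; rewrite prime_gt0 // ltnW.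
  by move=> pf; move: py; rewrite /y (dvdn_addr _ (dvdn_mull z pf)) dvdn1 gtn_eqF // prime_gt1.
have -> : v = (u * (g * y) + t) * w + f by rewrite hzy ht; ring.
apply: nestable_truncated => //.
- apply: leq_trans (leq_pmull y g0); apply: leq_trans (ltnW uty).
  exact: leq_addl.
- exact: gddw.
- exact/gddw/leqnSn.
- by have -> : g * y * w = y * (w * g) by [ring]; apply: hole; apply: leq_trans (ltnW uty); apply: leq_addr.
- by rewrite -ht.
Qed.

(** * Perfect nestings *)

Definition leaves lam (X : finType) (b : {ffun star_index lam -> X}) : {set X} :=
  [set b (Some i) | i : 'I_lam.*2.+1].

Lemma mem_leaves lam (X : finType) (b : {ffun star_index lam -> X}) i :
  b (Some i) \in leaves b.
Proof. by apply/imsetP; exists i. Qed.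

Lemma cov_eq0 lam (X : finType) t (b : {ffun star_index lam -> X}) x y :
  (forall i j, incid t i j -> x = b i -> y = b j -> False) -> cov t b x y = 0.
Proof.
by move=> h; apply/eqP; rewrite -leqn0 leqNgt; apply/negP => /cov_gt0 [i [j [hij ex ey]]]; apply: (h i j).
Qed.

Lemma cov_leaves lam (X : finType) (b : {ffun star_index lam -> X}) x y :
  injective b -> x != y ->
  cov false b x y = (x \in leaves b) && (y \in leaves b).
Proof.
move=> bi xy; case hxy: (_ && _).
  have /andP [/imsetP [i _ ex] /imsetP [j _ ey]] := hxy.
  have ij : Some i != Some j :> star_index lam.
    by apply: contraNneq xy => E; rewrite ex ey E.
  by rewrite ex ey cov_inj // /incid ij.
apply: cov_eq0 => -[i|] [j|] //= _ ex ey.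
by move: hxy; rewrite ex ey !mem_leaves.
Qed.

(** Two distinct points of an extended block form either a star edge or a leaf pair, never both;
    summing over blocks gives [1 + lam]. *)
Lemma cov_nested lam (X : finType) (b : {ffun star_index lam -> X}) x y :
  injective b -> x != y ->
  cov true b x y + cov false b x y =
  (x \in leaves b :|: [set b None]) && (y \in leaves b :|: [set b None]).
Proof.
move=> bi xy.
have lP i : b i \in leaves b :|: [set b None].
  by case: i => [i|]; rewrite !inE ?mem_leaves ?eqxx ?orbT.
have lP' z : z \in leaves b :|: [set b None] -> exists i, z = b i.
  by rewrite !inE => /orP [/imsetP [i _ ->]|/eqP ->]; [exists (Some i) | exists None].
case hxy: (_ && _).
  have /andP [/lP' [i ex] /lP' [j ey]] := hxy.
  have ij : i != j by apply: contraNneq xy => E; rewrite ex ey E.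
  rewrite ex ey !cov_inj //; have [[] ht] := incid_total ij; last first.
    by rewrite ht (negbTE (incid_excl ht)).
  by rewrite ht; case hf: (incid false i j) => //; have := incid_excl hf; rewrite ht.
by rewrite !cov_eq0 // => i j _ ex ey; move: hxy; rewrite ex ey !lP.
Qed.

Lemma nestable_perfect lam v : nestable lam v ->
  exists (X I : finType) (B : I -> {set X}),
    is_BIBD v lam.*2.+1 lam B /\
    exists phi : I -> X, is_perfect_nesting v lam.*2.+1 lam B phi.
Proof.
move=> [s hs].
pose b (q : 'I_(size s)) := tnth (in_tuple s) q.
have bi q : injective (b q).
  apply: (@dec_blocks_inj lam _ (fun x y : 'I_v => x != y) s) => //; last exact: mem_tnth.
  by move=> x; rewrite eqxx.
have hb t x y : \sum_q cov t (b q) x y = mult lam t * (x != y).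
  by rewrite -hs [RHS]big_tnth.
pose B q := leaves (b q); pose phi q := b q None.
have cB q : #|B q| = lam.*2.+1.
  by rewrite card_imset ?card_ord // => i j /bi [].
have cN q : #|nested_blocks B phi q| = lam.*2.+1 + 1.
  rewrite cardsU cB cards1 (_ : _ :&: _ = set0) ?cards0 ?subn0 //.
  by apply/setP => x; rewrite !inE; apply/andP => -[/imsetP [i _ ->] /eqP /bi].
have pB x y : x != y -> pair_count B x y = lam.
  move=> xy; rewrite -[RHS]muln1 -[1]/(true : nat) -xy -(hb false) /pair_count -sum1_card big_mkcond.
  by apply: eq_bigr => q _; rewrite inE cov_leaves //; case: (_ && _).
have pN x y : x != y -> pair_count (nested_blocks B phi) x y = lam + 1.
  move=> xy; have := congr2 addn (hb true x y) (hb false x y); rewrite xy -big_split /= mul1n !muln1 addnC => <-.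
  rewrite /pair_count -sum1_card big_mkcond.
  apply: eq_bigr => q _; rewrite cov_nested // inE -/(nested_blocks B phi q).
  by case: (_ && _).
have hB : is_BIBD v lam.*2.+1 lam B by split; rewrite ?card_ord.
exists 'I_v, 'I_(size s), B; split=> //; exists phi; split; last by split; rewrite ?card_ord.
by split=> //; split; rewrite ?card_ord // => x y xy; rewrite pN.
Qed.

Theorem theorem1p4 (lambda k : nat) (hlambda : 0 < lambda)
    (hk : k = 2 * lambda + 1) :
  exists v0 : nat, forall v : nat, v0 <= v -> v = 1 %[mod 2 * k] ->
    exists (X I : finType) (B : I -> {set X}),
      is_BIBD v k lambda B /\
      exists phi : I -> X, is_perfect_nesting v k lambda B phi.
Proof.
have {hk} -> : k = lambda.*2.+1 by rewrite hk addn1 mul2n.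
have [v0 h] := nestable_eventually hlambda; exists v0 => v vv; rewrite mul2n => vm.
exact/nestable_perfect/h.
Qed.
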